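(* Let $\mathbf P=(P_1,\ldots,P_r)$ be a sequence of polytopes in $\mathbb{R}^d$ such that $P=P_1+\cdots+P_r$ is full-dimensional, let $\mathcal S=\{\mathbf Q^{(1)},\mathbf Q^{(2)},\ldots,\mathbf Q^{(n)}\}$ be a mixed subdivision of $\mathbf P$, and let $\mathbf x=(x_1,\ldots,x_r)$. Then the dual mixed volume of $\mathbf P$ is the sum of the dual mixed volumes of the cells in $\mathcal S$: $$m_{\mathbf P}(\mathbf x,\mathbf z)=\sum_{\mathbf Q\in\mathcal S}m_{\mathbf Q}(\mathbf x,\mathbf z).$$
   Context: Minkowski cell of $\mathbf P$: a sequence $\mathbf Q=(Q_1,\dots,Q_r)$ where each $Q_i$ is a (possibly not full-dimensional) convex hull of some vertices of $P_i$ and $Q=Q_1+\cdots+Q_r$ satisfies $\dim(Q)=d$. Two polytopes intersect properly if their intersection is a proper face of both. Two Minkowski cells $\mathbf Q=(Q_1,\dots,Q_r)$ and $\mathbf Q'=(Q_1',\dots,Q_r')$ intersect properly as Minkowski sums if $Q_i$ intersects properly with $Q_i'$ for each $i=1,\dots,r$. Mixed subdivision: a collection of Minkowski cells $\{\mathbf Q^{(1)},\dots,\mathbf Q^{(n)}\}$, with sums $Q^{(a)}=Q^{(a)}_1+\cdots+Q^{(a)}_r$, such that $\bigcup_a Q^{(a)}=P$ and, for $a\ne b$, $\mathbf Q^{(a)}$ and $\mathbf Q^{(b)}$ intersect properly as Minkowski sums. Dual mixed volume function: put $h_Q(\mathbf v)=-\min_{\mathbf y\in Q}\langle\mathbf v,\mathbf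 y\rangle$. For a sequence $\mathbf P$ with $P=P_1+\cdots+P_r$ full-dimensional, let $\mathcal N(P)$ be the normal fan of $P$ (cones $\{\mathbf v:h_P(\mathbf v)=-\langle\mathbf v,\mathbf y\rangle\ \forall\mathbf y\in F\}$ for faces $F$ of $P$) and $\mathcal T$ any triangulation of $\mathcal N(P)$ into full-dimensional simplicial cones generated by rays of $\mathcal N(P)$. Then $$m_{\mathbf P}(\mathbf x,\mathbf z)=\sum_{C=\mathrm{span}_{\ge0}(\mathbf v_1,\dots,\mathbf v_d)\in\mathcal T}\frac{|\det(\mathbf v_1,\dots,\mathbf v_d)|}{\prod_{j=1}^d\bigl(\sum_{i=1}^r x_ih_{P_i}(\mathbf v_j)+\langle\mathbf v_j,\mathbf z\rangle\bigr)},$$ a rational function of $\mathbf x$ and $\mathbf z=(z_1,\dots,z_d)$, independent of $\mathcal T$ and of the scaling of generators.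
   Formalization: Corrected: with only the printed condition on cells the claim is false. Here Q_i∩Q_i' must be a (possibly empty or improper) face of both summands, and in addition Q∩Q' must be a proper (possibly empty) face of both sums and equal the Minkowski sum of the Q_i∩Q_i'. *)

(* Defs.v *)
(* MathComp, with the reals and classical sets of MathComp-Analysis. *)
From HB Require Import structures.
From mathcomp Require Import all_boot all_order all_algebra all_classical.
From mathcomp Require Import reals mpoly.

Set Implicit Arguments.
Unset Strict Implicit.
Unset Printing Implicit Defensive.

Import Order.TTheory GRing.Theory Num.Theory.

Local Open Scope classical_set_scope.
Local Open Scope ring_scope.

Section Polytopes.
Context {R : realType} {d : nat}.
Implicit Types (u v y : 'rV[R]_d) (A B F : set 'rV[R]_d).

Definition dot u v : R := \sum_k u 0 k * v 0 k.

Definition conv_hull A : set 'rV[R]_d :=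
  [set y | exists (k : nat) (w : 'I_k -> R) (p : 'I_k -> 'rV[R]_d),
    [/\ forall j, 0 <= w j, \sum_j w j = 1, forall j, A (p j)
      & y = \sum_j w j *: p j]].

Definition affine_hull A : set 'rV[R]_d :=
  [set y | exists (k : nat) (w : 'I_k -> R) (p : 'I_k -> 'rV[R]_d),
    [/\ \sum_j w j = 1, forall j, A (p j) & y = \sum_j w j *: p j]].

Definition is_polytope A : Prop :=
  exists2 s : seq 'rV[R]_d, s != [::] & A = conv_hull [set` s].

(* The dimension of [A] is [d]. *)
Definition full_dimensional A : Prop := affine_hull A = setT.

(* The empty set and [A] itself (take [v = 0]) are faces of [A]. *)
Definition is_face F A : Prop :=
  F = set0 \/
  exists v, F = [set y | A y /\ forall y', A y' -> dot v y <= dot v y'].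

Definition is_proper_face F A : Prop := is_face F A /\ F <> A.

Definition vertices A : set 'rV[R]_d := [set y | is_face [set y] A].

Definition intersect_properly A B : Prop :=
  is_proper_face (A `&` B) A /\ is_proper_face (A `&` B) B.

(* On a polytope the infimum is attained, hence is the minimum. *)
Definition support_fun A v : R := - inf [set dot v y | y in A].

Definition normal_cone A F : set 'rV[R]_d :=
  [set v | forall y, F y -> support_fun A v = - dot v y].

Definition normal_fan A : set (set 'rV[R]_d) :=
  [set normal_cone A F | F in [set F | is_face F A /\ F !=set0]].

(* The cone spanned by the rows of [C]. *)
Definition cone_of (C : 'M[R]_d) : set 'rV[R]_d :=
  [set \sum_j t j *: row j C | t in [set t : 'I_d -> R | forall j, 0 <= t j]].

Definition generates_ray_of (N : set (set 'rV[R]_d)) v : Prop :=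
  v != 0 /\ N [set t *: v | t in [set t : R | 0 <= t]].

(* A maximal cone of a triangulation is given by a matrix whose rows are
   generators of its rays. *)
Definition is_triangulation (N : set (set 'rV[R]_d)) (T : seq 'M[R]_d) : Prop :=
  [/\ uniq T,
      forall C, C \in T ->
        [/\ C \in unitmx,
            forall j, generates_ray_of N (row j C)
          & exists2 K, N K & cone_of C `<=` K],
      forall C C', C \in T -> C' \in T -> C != C' ->
        intersect_properly (cone_of C) (cone_of C')
    & \bigcup_(C in [set` T]) cone_of C = \bigcup_(K in N) K].

End Polytopes.

Section MixedSubdivisions.
Context {R : realType} {d r : nat}.
Implicit Types P Q : 'I_r -> set 'rV[R]_d.

Definition minkowski_sum P : set 'rV[R]_d :=
  [set \sum_i y i | y in [set y : 'I_r -> 'rV[R]_d | forall i, P i (y i)]].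

Definition is_minkowski_cell P Q : Prop :=
  (forall i, exists2 A, A `<=` vertices (P i) & Q i = conv_hull A) /\
  full_dimensional (minkowski_sum Q).

(* The intersection of two corresponding summands may be all of one of them,
   as for [({0}, [0,1])] and [([0,1], {1})], which subdivide [([0,1], [0,1])].
   The condition on the summands alone does not even prevent the sums of the
   cells from overlapping: [({1}, [0,1])] and [([0,1], {1})] satisfy it.
   The cells have to intersect properly as polytopes as well, in a common face
   that both of them decompose as the sum of the [Q i `&` Q' i]. *)
Definition intersect_properly_as_sums Q Q' : Prop :=
  [/\ forall i, is_face (Q i `&` Q' i) (Q i) /\ is_face (Q i `&` Q' i) (Q' i),
      intersect_properly (minkowski_sum Q) (minkowski_sum Q')
    & minkowski_sum Q `&` minkowski_sum Q'
      = minkowski_sum (fun i => Q i `&` Q' i)].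

Definition is_mixed_subdivision P (n : nat)
    (Q : 'I_n -> 'I_r -> set 'rV[R]_d) : Prop :=
  [/\ forall a, is_minkowski_cell P (Q a),
      \bigcup_(a in [set: 'I_n]) minkowski_sum (Q a) = minkowski_sum P
    & forall a b, a != b -> intersect_properly_as_sums (Q a) (Q b)].

End MixedSubdivisions.

Section DualMixedVolume.
Context {R : realType} {d r : nat}.
Implicit Types P : 'I_r -> set 'rV[R]_d.

(* The first [r] variables are the [x_i], the last [d] are the [z_k]. *)
Definition support_form P (v : 'rV[R]_d) : {mpoly R[r + d]} :=
  \sum_(i < r) support_fun (P i) v *: 'X_(lshift d i)
  + \sum_(k < d) v 0 k *: 'X_(rshift r k).

(* Computed from a triangulation [T] of the normal fan of
   [minkowski_sum P]. *)
Definition dual_mixed_volume P (T : seq 'M[R]_d) :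
    {fraction {mpoly R[r + d]}} :=
  \sum_(C <- T) tofrac (`|\det C|%:MP)
                / \prod_(j < d) tofrac (support_form P (row j C)).

End DualMixedVolume.

(* Main.v *)
(* The triangulation of a normal fan splits the dual mixed volume over the
   vertices y of the polytope: each contributes the rational function
   phi(K^* ) of w = z - sum_i x_i p_i, where K is the tangent cone at y, K^* its
   dual cone, y = sum_i p_i the decomposition of y into vertices of the summands,
   and phi(cone(v_1, ..., v_d)) = |det(v_j)| / prod_j <v_j, w>.  All cells with
   vertex y share the same p_i, so it is enough to treat one y at a time, where
   the tangent cones of the cells subdivide that of P.

   It remains to see that phi(K^* ) is additive in K: if sum_a c_a [K_a] = 0
   outside finitely many hyperplanes, and sum_a c_a [K_a^*] = sum_i c_i [C_i] there
   for simplicial cones C_i, then sum_i c_i phi(C_i) = 0.  This goes by induction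
   on d, as Stokes' theorem for exp(- <v, w>) would suggest.  For a generic q,
   <q, w> phi(C) is a sum over the facets of C.  The facets in a hyperplane e^\bot
   add up to the jump of sum_a c_a [K_a^*] across it, which comes from the K_a
   containing e or - e and is the sum of the [(K_a / e)^*]; and the K_a / e again
   satisfy a linear relation, the limit of the first one far away in the
   direction of e. *)
Require Import Defs.
From mathcomp Require Import all_boot all_order all_algebra all_classical.
From mathcomp Require Import reals mpoly ring lra.

Set Implicit Arguments.
Unset Strict Implicit.
Unset Printing Implicit Defensive.

Import Order.TTheory GRing.Theory Num.Theory.

Local Open Scope ring_scope.

(** * Evaluation of rational functions *)

Section Evaluation.
Context {R : numDomainType}.

(** The integers [0, ..., size p - 1] are distinct, and there is one more of them than the degree
    allows as roots. *)
Lemma poly_nonroot (p : {poly R}) : p != 0 -> exists s, p.[s] != 0.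
Proof.
move=> p0; apply/not_existsP => H.
have := @max_poly_roots R p [seq i%:R | i <- iota 0 (size p)] p0.
rewrite map_inj_in_uniq ?iota_uniq; last first.
  by move=> i j _ _ /eqP; rewrite eqr_nat => /eqP.
rewrite size_map size_iota ltnn => F.
suff: false by []. 
apply: F => //; apply/allP => s _; rewrite /root.
by apply/negPn/negP => /H.
Qed.

Lemma meval_muni n (p : {mpoly R[n.+1]}) (rho : 'I_n.+1 -> R) :
  p.@[rho] =
  (map_poly (meval (fun i => rho (widen_ord (leqnSn n) i))) (muni p)).[rho ord_max].
Proof.
rewrite muniE mevalE raddf_sum horner_sum; apply: eq_bigr => m _ /=.
rewrite map_polyZ map_polyXn hornerZ hornerXn /= mevalZ mevalX big_ord_recr /=.
by rewrite mulrA; congr (_ * _ * _); apply: eq_bigr => i _; rewrite mnmE.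
Qed.

(** Any monomial [m] of the support survives: split off its last exponent and read the coefficient
    of [p] at [m] back from [muni p]. *)
Lemma muni_neq0 n (p : {mpoly R[n.+1]}) : p != 0 -> muni p != 0.
Proof.
move=> p0; have [m mp] : exists m, m \in msupp p.
  have := p0; rewrite -msupp_eq0; case: (msupp p) => [|m s] // _.
  by exists m; rewrite inE eqxx.
have : p@_m != 0 by rewrite -mcoeff_msupp.
apply: contra => /eqP /(congr1 (fun q : {poly _} =>
   (q`_(m ord_max))@_[multinom (m (widen_ord (leqnSn n) i)) | i < n])).
rewrite coef0 mcoeff0 muniE coef_sum raddf_sum /= => <-; apply/eqP.
rewrite (bigD1_seq m) ?msupp_uniq //= coefZ coefXn eqxx mulr1.
rewrite mcoeffZ mcoeffX eqxx mulr1 big1 ?addr0 // => m' m'm.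
rewrite coefZ coefXn; case: eqP => [E|]; last by rewrite mulr0 mcoeff0.
rewrite mulr1 mcoeffZ mcoeffX; case: eqP => [E'|]; last by rewrite mulr0.
case/eqP: m'm; apply/mnmP => i.
have [j ->|->] := unliftP ord_max i; last by rewrite E.
move/mnmP/(_ j): E'; rewrite !mnmE.
by rewrite (_ : lift _ _ = widen_ord (leqnSn n) j) //; apply/val_inj/lift_max.
Qed.

Lemma mpoly_nonroot n (p : {mpoly R[n]}) : p != 0 -> exists rho, p.@[rho] != 0.
Proof.
elim: n p => [|n IH] p p0.
  exists (fun=> 0); apply: contra p0 => /eqP E; apply/eqP/mpolyP => m.
  move: E; rewrite mevalE mcoeff0.
  have all0 (m' : 'X_{1..0}) : m' = m by apply/mnmP => -[].
  have [mp|/memN_msupp_eq0 //] := boolP (m \in msupp p).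
  rewrite (bigD1_seq m) ?msupp_uniq //= big_ord0 mulr1 big1 ?addr0 // => m'.
  by rewrite (all0 m') eqxx.
(* First choose the leading variables so that the leading coefficient in the last variable survives,
   then choose the last one. *)
have : lead_coef (muni p) != 0 by rewrite lead_coef_eq0 muni_neq0.
move/IH => [rho h].
have /poly_nonroot [s hs] : map_poly (meval rho) (muni p) != 0.
  apply: contra h => /eqP /(congr1 (fun q : {poly _} => q`_(size (muni p)).-1)).
  by rewrite coef_map coef0 => ->.
exists (fun i => oapp rho s (unlift ord_max i)).
rewrite meval_muni unlift_none /=.
rewrite (_ : map_poly _ _ = map_poly (meval rho) (muni p)) //.
apply: eq_map_poly => q; apply: meval_eq => i.
rewrite (_ : widen_ord _ i = lift ord_max i) ?liftK //.
exact/val_inj/esym/lift_max.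
Qed.

End Evaluation.

(** * Testing identities of rational functions at points *)

Section Fractions.
Context {R : numFieldType} {n : nat} {I : eqType}.
Implicit Types (l : seq I) (a : I -> R).

(** The denominator built is the product of all [D i], so wherever it is nonzero each summand can be
    evaluated separately. *)
Lemma sum_tofrac l a (D : I -> {mpoly R[n]}) :
  (forall i, i \in l -> D i != 0) ->
  exists num den : {mpoly R[n]}, [/\ den != 0,
    \sum_(i <- l) tofrac (a i)%:MP / tofrac (D i) = tofrac num / tofrac den &
    forall rho, den.@[rho] != 0 ->
      (forall i, i \in l -> (D i).@[rho] != 0) /\
      \sum_(i <- l) a i / (D i).@[rho] = num.@[rho] / den.@[rho]].
Proof.
elim: l => [_|i l IH Dl].
  exists 0, 1; rewrite !big_nil oner_eq0 rmorph0 mul0r; split=> // rho _.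
  by rewrite big_nil meval0 mul0r.
have [j jl|num [den [den0 E evE]]] := IH.
  by apply: Dl; rewrite inE jl orbT.
have Di0 : D i != 0 by apply: Dl; rewrite mem_head.
exists ((a i)%:MP * den + num * D i), (D i * den); split.
- by rewrite mulf_neq0.
- by rewrite big_cons E addf_div ?tofrac_eq0 // !rmorphD !rmorphM.
move=> rho; rewrite mevalM mulf_eq0 negb_or.
move=> /andP[h1 /[dup] h4 /evE[h2 h3]]; split.
  by move=> j; rewrite inE => /predU1P[->//|/h2].
rewrite big_cons h3 addf_div // mevalD !mevalM mevalC //.
Qed.

Lemma sum_tofrac_eq0 l a k (D : I -> 'I_k -> {mpoly R[n]}) :
  (forall i j, i \in l -> D i j != 0) ->
  (forall rho, (forall i j, i \in l -> (D i j).@[rho] != 0) ->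
     \sum_(i <- l) a i / \prod_j (D i j).@[rho] = 0) ->
  \sum_(i <- l) tofrac (a i)%:MP / \prod_j tofrac (D i j) = 0.
Proof.
move=> D0 ev0.
have [|num [den [den0 E evE]]] := @sum_tofrac l a (fun i => \prod_j D i j).
  by move=> i il; apply/prodf_neq0 => j _; apply: D0.
under eq_bigr do rewrite -rmorph_prod.
rewrite E; apply/eqP; rewrite mulf_eq0 tofrac_eq0; apply/orP; left.
(* Were the numerator nonzero, [num * den] would be nonzero at some point; every summand is defined
   there, which contradicts the pointwise hypothesis. *)
apply/negP => /negP num0.
have [rho] := mpoly_nonroot (mulf_neq0 num0 den0).
rewrite mevalM mulf_eq0 negb_or => /andP[h /[dup] hd /evE[h1 h2]].
have {}h1 i j : i \in l -> (D i j).@[rho] != 0.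
  by move=> /h1; rewrite rmorph_prod => /prodf_neq0; apply.
suff : num.@[rho] / den.@[rho] = 0.
  by move/eqP; rewrite mulf_eq0 invr_eq0 (negPf h) (negPf hd).
by rewrite -h2 -[RHS](ev0 _ h1); apply: eq_bigr => i _; rewrite rmorph_prod.
Qed.

End Fractions.

(** * Polyhedral cones *)

Section Pairing.
Context {R : comNzRingType}.

(** Linear forms are rows and points are columns, so a cone and its dual live in different types. *)
Definition pairing d (v : 'rV[R]_d) (y : 'cV[R]_d) : R := (v *m y) 0 0.

Context {d : nat}.
Implicit Types (v : 'rV[R]_d) (y : 'cV[R]_d).

Lemma pairingDl v v' y : pairing (v + v') y = pairing v y + pairing v' y.
Proof. by rewrite /pairing mulmxDl mxE. Qed.
Lemma pairingDr v y y' : pairing v (y + y') = pairing v y + pairing v y'.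
Proof. by rewrite /pairing mulmxDr mxE. Qed.
Lemma pairingNl v y : pairing (- v) y = - pairing v y.
Proof. by rewrite /pairing mulNmx mxE. Qed.
Lemma pairingNr v y : pairing v (- y) = - pairing v y.
Proof. by rewrite /pairing mulmxN mxE. Qed.
Lemma pairingZl a v y : pairing (a *: v) y = a * pairing v y.
Proof. by rewrite /pairing -scalemxAl mxE. Qed.
Lemma pairingZr a v y : pairing v (a *: y) = a * pairing v y.
Proof. by rewrite /pairing -scalemxAr mxE. Qed.
Lemma pairing0r v : pairing v 0 = 0.
Proof. by rewrite /pairing mulmx0 mxE. Qed.
Lemma pairing_mulmx d' v (A : 'M[R]_(d, d')) z :
  pairing v (A *m z) = pairing (v *m A) z.
Proof. by rewrite /pairing mulmxA. Qed.

Lemma pairing_scaler v y d' (z : 'cV[R]_d') : z *m v *m y = pairing v y *: z.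
Proof.
by rewrite -mulmxA [v *m y]mx11_scalar mul_mx_scalar.
Qed.

End Pairing.

Section SmallParameter.
Context {R : realFieldType}.
Implicit Types (P Q : R -> Prop) (a b e : R).

(** Properties of germs at 0 from the right. They take the place of limits in all perturbation
    arguments. *)
Definition small P := exists2 e, 0 < e & forall x, 0 < x < e -> P x.

Lemma small_and P Q : small P -> small Q -> small (fun e => P e /\ Q e).
Proof.
move=> [e e0 He] [f f0 Hf]; exists (Num.min e f).
  by rewrite lt_min e0 f0.
move=> x; rewrite lt_min => /and3P[x0 xe xf]; split.
  by apply: He; rewrite x0.
by apply: Hf; rewrite x0.
Qed.

Lemma small_imp P Q : (forall e, 0 < e -> P e -> Q e) -> small P -> small Q.
Proof.
by move=> PQ [e e0 He]; exists e => // x /[dup] /andP[x0 _] /He /(PQ _ x0).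
Qed.

Lemma small_all (I : eqType) (l : seq I) (P : I -> R -> Prop) :
  (forall i, i \in l -> small (P i)) -> small (fun e => forall i, i \in l -> P i e).
Proof.
elim: l => [_|i l IH H]; first by exists 1.
have [|h] := small_and (H i (mem_head _ _)) (IH _).
  by move=> j jl; apply: H; rewrite inE jl orbT.
move=> h0 Hh; exists h => // x /Hh [h1 h2] j; rewrite inE => /predU1P[->|] //.
exact: h2.
Qed.

Lemma small_ex P : small P -> exists2 e, 0 < e & P e.
Proof.
move=> [e e0 He]; exists (e / 2); first by lra.
by apply: He; lra.
Qed.

Lemma small_sg a b :
  small (fun e => Num.sg (a + e * b) = if a == 0 then Num.sg b else Num.sg a).
Proof.
have [->|a0] := eqVneq a 0.
  by exists 1 => // x /andP[x0 _]; rewrite add0r sgrM gtr0_sg ?mul1r.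
(* The [+ 1] keeps the denominator positive when [b = 0]. *)
exists (`|a| / (`|b| + 1)).
  by rewrite divr_gt0 ?normr_gt0 // ltr_wpDl.
move=> x /andP[x0]; rewrite ltr_pdivlMr ?ltr_wpDl // => xb.
have {xb}: `|x * b| < `|a|.
  apply: le_lt_trans xb; rewrite normrM (gtr0_norm x0).
  by rewrite ler_wpM2l ?lerDl // ltW.
rewrite ltr_norml => /andP[h1 h2].
case: (ltrgt0P a) a0 h1 h2 => // ha _ h1 h2; rewrite ?(gtr0_sg ha) ?(ltr0_sg ha).
  by rewrite gtr0_sg //; lra.
by rewrite ltr0_sg //; lra.
Qed.

Lemma small_neq0 a b : (a != 0) || (b != 0) -> small (fun e => a + e * b != 0).
Proof.
move=> ab; apply: small_imp (small_sg a b) => e _ E; rewrite -sgr_eq0 E.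
by move: ab; case: eqVneq => a0; rewrite ?sgr_eq0.
Qed.

Lemma small_gt0 a b : 0 < a -> small (fun e => 0 < a + e * b).
Proof.
move=> a0; apply: small_imp (small_sg a b) => e _.
by rewrite (gt_eqF a0) (gtr0_sg a0) => h; rewrite -sgr_gt0 h ltr01.
Qed.

Lemma small_ge0 a b :
  small (fun e => (0 <= a + e * b) = if a == 0 then 0 <= b else 0 <= a).
Proof.
apply: small_imp (small_sg a b) => e _ E.
by rewrite -sgr_ge0 E; case: eqP => _; rewrite sgr_ge0.
Qed.

End SmallParameter.

Section Cones.
Context {R : realFieldType} {d : nat}.
Implicit Types (G : seq 'cV[R]_d) (v : 'rV[R]_d) (g y : 'cV[R]_d).

(** The recursion peels off one generator with its coefficient, which suits induction on the
    generators. *)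
Fixpoint in_cone G y : Prop :=
  if G is g :: G' then exists2 l, 0 <= l & in_cone G' (y - l *: g) else y = 0.

Definition dual_cone G v := all (fun g => 0 <= pairing v g) G.

Lemma in_cone0 G : in_cone G 0.
Proof. by elim: G => //= g G IH; exists 0; rewrite // scale0r subr0. Qed.

Lemma in_coneD G y y' : in_cone G y -> in_cone G y' -> in_cone G (y + y').
Proof.
elim: G y y' => [|g G IH] y y' /=; first by move=> -> ->; rewrite addr0.
move=> [l l0 h] [l' l'0 h']; exists (l + l'); first exact: addr_ge0.
by rewrite scalerDl opprD addrACA; apply: IH.
Qed.

Lemma in_coneZ G a y : 0 <= a -> in_cone G y -> in_cone G (a *: y).
Proof.
move=> a0; elim: G y => [|g G IH] y /=; first by move=> ->; rewrite scaler0.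
move=> [l l0 h]; exists (a * l); first exact: mulr_ge0.
by rewrite -scalerA -scalerBr; apply: IH.
Qed.

Lemma mem_in_cone G g : g \in G -> in_cone G g.
Proof.
elim: G => //= g' G IH; rewrite inE => /predU1P[->|/IH h].
  by exists 1; rewrite // scale1r subrr; apply: in_cone0.
by exists 0; rewrite // scale0r subr0.
Qed.

Lemma in_cone_ge0 G v y : dual_cone G v -> in_cone G y -> 0 <= pairing v y.
Proof.
elim: G y => [|g G IH] y /=; first by move=> _ ->; rewrite pairing0r.
move=> /andP[h1 h2] [l l0 /(IH _ h2)].
rewrite pairingDr pairingNr pairingZr subr_ge0; apply: le_trans.
exact: mulr_ge0.
Qed.

End Cones.

Lemma in_cone_map (R : realFieldType) d d' (M : 'M[R]_(d', d)) G y :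
  in_cone G y -> in_cone (map (mulmx M) G) (M *m y).
Proof.
elim: G y => [|g G IH] y /=; first by move=> ->; rewrite mulmx0.
by move=> [l l0 /IH h]; exists l; rewrite // scalemxAr -mulmxBr.
Qed.

Lemma in_cone_map_inv (R : realFieldType) d d' (M : 'M[R]_(d', d)) G y' :
  in_cone (map (mulmx M) G) y' -> exists2 y, in_cone G y & M *m y = y'.
Proof.
elim: G y' => [|g G IH] y' /=; first by move=> ->; exists 0; rewrite ?mulmx0.
move=> [l l0 /IH [y h E]]; exists (y + l *: g).
  by exists l; rewrite ?addrK.
by rewrite mulmxDr E -scalemxAr subrK.
Qed.

(** Induction on the number of generators. A form [v] separating [y] from all generators but [g]
    either works for [g] too, or is negative on it; then project along [g] and separate the
    images. *)
Lemma farkas (R : realFieldType) d (G : seq 'cV[R]_d) y :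
  ~ in_cone G y -> exists2 v, dual_cone G v & pairing v y < 0.
Proof.
have [n] := ubnP (size G); elim: n => // n IH in G y *.
case: G => [|g G] /= sG nG.
  exists (- y^T) => //; rewrite pairingNl oppr_lt0 /pairing mxE.
  have /matrix0Pn [i [j]] : y != 0 by apply/eqP.
  rewrite ord1 => yi; rewrite (bigD1 i) //= mxE ltr_pwDl //.
    by rewrite -expr2 exprn_even_gt0.
  by apply: sumr_ge0 => k _; rewrite mxE -expr2 sqr_ge0.
have [|v Gv vy] := IH G y sG.
  by move=> h; apply: nG; exists 0; rewrite // scale0r subr0.
have [vg|vg] := leP 0 (pairing v g); first by exists v; rewrite //= vg.
(* [A] is the projection onto the kernel of [v] along [g]; forms of the shape [u *m A] therefore
   vanish on [g]. *)
pose A : 'M_d := 1%:M - (pairing v g)^-1 *: (g *m v).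
have AE z : A *m z = z - (pairing v z / pairing v g) *: g.
  rewrite mulmxBl mul1mx -scalemxAl pairing_scaler scalerA.
  by rewrite [_^-1 * _]mulrC.
have [||u uG uy] := IH (map (mulmx A) G) (A *m y).
- by rewrite size_map.
- move=> /in_cone_map_inv [y0 Gy0]; rewrite !AE => E; apply: nG.
  (* The coefficient of [g] that [A] forgets. It is positive, since [v] is negative on [y] and [g]
     and nonnegative on [y0]. *)
  exists ((pairing v y - pairing v y0) / pairing v g).
    rewrite ltW // ltr_ndivlMr // mul0r subr_lt0.
    by rewrite (lt_le_trans vy) // (in_cone_ge0 Gv).
  suff -> : y - ((pairing v y - pairing v y0) / pairing v g) *: g = y0 by [].
  by rewrite mulrBl scalerBl opprB addrA addrAC -E subrK.
exists (u *m A); last by rewrite -pairing_mulmx.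
apply/andP; split.
  by rewrite -pairing_mulmx AE divff ?lt_eqF // scale1r subrr pairing0r.
by move: uG; rewrite /dual_cone all_map; under eq_all do rewrite /= pairing_mulmx.
Qed.

(** Take [q] on the moment curve [(1, s, s^2, ...)]: pairing it with [g] evaluates at [s] a nonzero
    polynomial with coefficients [g], and finitely many such polynomials have a common nonroot. *)
Lemma generic_row (R : realFieldType) d (l : seq 'cV[R]_d.+1) :
  (forall g, g \in l -> g != 0) ->
  exists2 q : 'rV[R]_d.+1, q 0 0 = 1 & forall g, g \in l -> pairing q g != 0.
Proof.
move=> l0.
pose p (g : 'cV[R]_d.+1) := \poly_(i < d.+1) g (inord i) 0.
have p0 g : g \in l -> p g != 0.
  move=> /l0 /matrix0Pn [i [j]]; rewrite ord1; apply: contra => /eqP.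
  move=> /(congr1 (fun r : {poly R} => r`_i)).
  by rewrite coef_poly ltn_ord inord_val coef0 => ->.
have : \prod_(g <- l) p g != 0.
  by rewrite prodf_seq_neq0; apply/allP => g; apply: p0.
move=> /poly_nonroot [s]; rewrite horner_prod prodf_seq_neq0 => /allP H.
exists (\row_i s ^+ i); first by rewrite mxE expr0.
move=> g gl; have := H g gl.
apply: contra => /eqP E; rewrite horner_poly -[X in _ == X]E /pairing mxE.
by apply/eqP/eq_bigr => i _; rewrite mxE inord_val mulrC.
Qed.

(* A decomposition of the space as the line spanned by [c] plus the kernel of
   [q], with [M] and [L] the projection on and the inclusion of the latter. *)
Record splitting (R : realFieldType) n d (q : 'rV[R]_n) (c : 'cV[R]_n)
  (M : 'M[R]_(d, n)) (L : 'M[R]_(n, d)) : Prop := Splitting {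
  split_qc : q *m c = 1%:M;
  split_Mc : M *m c = 0;
  split_qL : q *m L = 0;
  split_ML : M *m L = 1%:M;
  split_1 : c *m q + L *m M = 1%:M }.

Lemma splitting_block (R : realFieldType) d (b : 'rV[R]_d) (al : 'M[R]_1)
    (a : 'cV[R]_d) : al + b *m a = 1%:M ->
  splitting (row_mx 1%:M b) (col_mx al a) (row_mx (- a) (1%:M - a *m b))
    (col_mx (- b) 1%:M).
Proof.
move=> alba; have ba : b *m a = 1%:M - al by rewrite -alba addrC addKr.
split.
- by rewrite mul_row_col mul1mx.
- rewrite mul_row_col mulmxBl mul1mx -mulmxA ba mulmxBr mulmx1 mulNmx.
  by rewrite opprB (addrC a) subrK addNr.
- by rewrite mul_row_col mul1mx mulmx1 addNr.
- by rewrite mul_row_col mulNmx mulmxN opprK mulmx1 addrC subrK.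
rewrite !mul_col_row !mulmx1 !mul1mx add_block_mx.
rewrite mulNmx mulmxN opprK ba (addrC al) subrK subrr (addrC (a *m b)) subrK.
by rewrite mulNmx mulmxBr mulmx1 mulmxA ba mulmxBl mul1mx subKr subrr
  -scalar_mx_block.
Qed.

(** A first entry 1 puts [q] in the form [(1, b)], for which the kernel has an explicit basis. *)
Lemma ex_splitting (R : realFieldType) d (q : 'rV[R]_d.+1) c :
  q 0 0 = 1 -> pairing q c = 1 -> 
  exists (M : 'M_(d, d.+1)) (L : 'M_(d.+1, d)), splitting q c M L.
Proof.
rewrite /pairing => q00 /(congr1 (@scalar_mx R 1)); rewrite -mx11_scalar.
pose q' : 'rV[R]_(1 + d) := q; pose c' : 'cV[R]_(1 + d) := c.
have q1 : lsubmx q' = 1%:M.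
  apply/matrixP => i j; rewrite !ord1 !mxE /= -[RHS]q00; congr (q _ _).
  exact: val_inj.
have -> : q = row_mx 1%:M (rsubmx q') by rewrite -q1 hsubmxK.
have -> : c = col_mx (usubmx c') (dsubmx c') by rewrite vsubmxK.
rewrite (mul_row_col 1%:M (rsubmx q')) mul1mx => /splitting_block h.
by do 2!eexists; apply: h.
Qed.

(** * Jumps of dual cones across a hyperplane *)

Section Splitting.
Context {R : realFieldType} {n d : nat} {q : 'rV[R]_n} {c : 'cV[R]_n}
  {M : 'M[R]_(d, n)} {L : 'M[R]_(n, d)} (S : splitting q c M L).
Implicit Types (G : seq 'cV[R]_n) (g y z : 'cV[R]_n) (u : 'rV[R]_d) (s t : R).

Lemma splitting_pairing : pairing q c = 1.
Proof. by rewrite /pairing (split_qc S) mxE. Qed.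

Lemma splitting_ker z : M *m z = 0 -> z = pairing q z *: c.
Proof.
move=> Mz; rewrite -[LHS]mul1mx -(split_1 S) mulmxDl -(mulmxA L) Mz mulmx0 addr0.
exact: pairing_scaler.
Qed.

(** Only generators on the line of [c] matter: they must not oppose a move of the linear form in the
    direction [s *: q]. *)
Definition side s G := all (fun g => (M *m g != 0) || (0 <= s * pairing q g)) G.

Definition avoids u G :=
  forall g, g \in G -> M *m g != 0 -> pairing u (M *m g) != 0.

(** [u *m M] is a form vanishing on [c], and [e *: (s *: q)] pushes it off that hyperplane.
    Generators with nonzero image are decided by [u], those on the line of [c] by the push. *)
Lemma dual_cone_side s G u : avoids u G ->
  small (fun e => dual_cone G (u *m M + e *: (s *: q)) =
                  side s G && dual_cone (map (mulmx M) G) u).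
Proof.
move=> uG; have := @small_all R _ G (fun g e =>
  (0 <= pairing u (M *m g) + e * (s * pairing q g)) =
  if pairing u (M *m g) == 0 then 0 <= s * pairing q g
  else 0 <= pairing u (M *m g)) (fun g _ => small_ge0 _ _).
apply: small_imp => e _ H.
rewrite /dual_cone all_map -all_predI; apply: eq_in_all => g gG /=.
rewrite pairingDl !pairingZl -pairing_mulmx H //.
have [->|Mg] := eqVneq (M *m g) 0; last by rewrite (negPf (uG _ _ _)).
by rewrite pairing0r eqxx lexx andbT.
Qed.

(** A generator violating [side (- s)] is a positive multiple of [s *: c]. If there is none, pushing
    [u *m M] by a little of [- s *: q] gives a form of the dual cone that is negative on
    [s *: c]. *)
Lemma in_cone_side s G u : s * s = 1 -> avoids u G ->
  dual_cone (map (mulmx M) G) u -> in_cone G (s *: c) <-> ~~ side (- s) G.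
Proof.
move=> ss uG Gu; split=> [Gc|/allPn [g gG]].
  apply/negP => sG; have [e e0] := small_ex (dual_cone_side (- s) uG).
  rewrite sG Gu => /in_cone_ge0 /(_ Gc).
  rewrite pairingDl -pairing_mulmx -scalemxAr (split_Mc S) scaler0 pairing0r.
  rewrite add0r !pairingZl pairingZr splitting_pairing mulr1 mulNr ss.
  by rewrite mulrN1 oppr_ge0 leNgt e0.
rewrite negb_or negbK -ltNge mulNr oppr_lt0 => /andP[/eqP /splitting_ker E sg].
have qg : pairing q g != 0 by apply: contraTneq sg => ->; rewrite mulr0 ltxx.
rewrite (_ : s *: c = (s / pairing q g) *: g).
  apply: in_coneZ (mem_in_cone gG).
  by rewrite -(pmulr_lge0 _ sg) mulrACA ss mulVf ?mulr1 ?ler01.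
by rewrite E pairingZr splitting_pairing mulr1 scalerA divfK.
Qed.

Lemma jump_in_cone G u : avoids u G ->
  (side 1 G && dual_cone (map (mulmx M) G) u)%:R
  - (side (-1) G && dual_cone (map (mulmx M) G) u)%:R
  = (`[< in_cone G c >]%:R - `[< in_cone G (- c) >]%:R)
    * (dual_cone (map (mulmx M) G) u)%:R :> R.
Proof.
move=> uG; have [Gu|_] := boolP (dual_cone _ u); last first.
  by rewrite !andbF subrr mulr0.
rewrite !andbT mulr1.
have := in_cone_side (mulr1 1) uG Gu; rewrite scale1r.
move=> H1.
have := in_cone_side (etrans (mulrNN 1 1) (mulr1 1)) uG Gu.
rewrite scaleN1r opprK => H2.
rewrite (asbool_equiv_eq H1) (asbool_equiv_eq H2) !asboolb.
by case: (side 1 G); case: (side (-1) G); rewrite /= ?subrr ?subr0 ?sub0r.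
Qed.

End Splitting.

(** Near [c] a cone containing [c] looks like the preimage of its quotient by the line of [c]: if
    [y = z + t *: c] with [z] in the cone, then [c + e *: y = (1 + e * t) *: c + e *: z]. If [c] is
    outside, Farkas separates a neighbourhood. *)
Lemma in_cone_small (R : realFieldType) n d (M : 'M[R]_(d, n)) c :
  M *m c = 0 -> (forall z, M *m z = 0 -> exists t, z = t *: c) ->
  forall G y, small (fun e =>
    in_cone G (c + e *: y) <-> in_cone G c /\ in_cone (map (mulmx M) G) (M *m y)).
Proof.
move=> Mc kerM G y.
have [Gc|nGc] := pselect (in_cone G c); last first.
  have [v Gv vc] := farkas nGc.
  have vc0 : 0 < - pairing v c by rewrite oppr_gt0.
  apply: small_imp (small_gt0 (- pairing v y) vc0) => e _ h; split; last by case.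
  move=> /(in_cone_ge0 Gv); rewrite pairingDr pairingZr; lra.
have [/[dup] Gy /in_cone_map_inv [z Gz /eqP]|nGy] :=
    pselect (in_cone (map (mulmx M) G) (M *m y)); last first.
  exists 1 => // e /andP[e0 _]; split; last by case.
  move=> /(in_cone_map M); rewrite mulmxDr Mc add0r -scalemxAr.
  have ie : 0 <= e^-1 by rewrite invr_ge0 ltW.
  by move=> /(in_coneZ ie); rewrite scalerA mulVf ?gt_eqF // scale1r.
rewrite eq_sym -subr_eq0 -mulmxBr => /eqP /kerM [t yz].
apply: small_imp (small_gt0 t ltr01) => e e0 h; split=> // _.
rewrite -(subrK z y) yz scalerDr scalerA addrA -{1}[c]scale1r -scalerDl.
by apply: in_coneD; apply: in_coneZ; rewrite // ltW.
Qed.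

Lemma pairing_col (R : comNzRingType) n m (v : 'rV[R]_n) (A : 'M[R]_(n, m)) j :
  pairing v (col j A) = (v *m A) 0 j.
Proof. by rewrite /pairing !mxE; apply: eq_bigr => i _; rewrite mxE. Qed.

Lemma all_enum (T : finType) (p : pred T) : all p (enum T) = [forall x, p x].
Proof.
by apply/allP/forallP => H x; [rewrite H ?mem_enum|move=> _; apply: H].
Qed.

(** Inner facet normals of the cone spanned by the rows of [C]: the entries of [v *m invmx C] are
    the coordinates of [v] in these rows. *)
Definition normals (R : comUnitRingType) d (C : 'M[R]_d) : seq 'cV[R]_d :=
  [seq col j (invmx C) | j <- enum 'I_d].

(** * Facets of a simplicial cone *)

Section SimplicialCone.
Context {R : realFieldType} {d : nat} {q : 'rV[R]_d.+1} {c : 'cV[R]_d.+1}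
  {M : 'M[R]_(d, d.+1)} {L : 'M[R]_(d.+1, d)} (S : splitting q c M L).
Context (C : 'M[R]_d.+1).
Context (uC : C \in unitmx).
Local Notation e j := (col j (invmx C)).
Context (qe : forall j, pairing q (e j) != 0).
Implicit Types (j k : 'I_d.+1) (u : 'rV[R]_d).

Let row'_mul j m (A : 'M[R]_(d.+1, m)) : row' j C *m A = row' j (C *m A).
Proof.
by apply/matrixP => a b; rewrite !mxE; apply: eq_bigr => i _; rewrite mxE.
Qed.

Let mul_col k : C *m e k = col k 1%:M.
Proof.
rewrite -(mulmxV uC); apply/matrixP => a b; rewrite !mxE.
by apply: eq_bigr => i _; rewrite !mxE.
Qed.

(** The facet opposite to row [j]; when it lies in the hyperplane of forms vanishing on [c],
    multiplying by [L] gives its coordinates there. *)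
Definition facet j : 'M[R]_d := row' j C *m L.

Lemma facet_normalE j : ((pairing q (e j))^-1 *: e j == c) = (M *m e j == 0).
Proof.
apply/eqP/eqP => [E|/(splitting_ker S) ->].
  by rewrite -[e j](scalerKV (qe j)) E -scalemxAr (split_Mc S) scaler0.
by rewrite pairingZr (splitting_pairing S) mulr1 scalerK.
Qed.

Lemma facet_normal_inj j k : M *m e j = 0 -> M *m e k = 0 -> j = k.
Proof.
move=> /(splitting_ker S) Ej /(splitting_ker S) Ek; apply/eqP.
have : (C *m e j) j 0 != 0 by rewrite mul_col !mxE eqxx oner_eq0.
apply: contraNT => jk.
have Ec : c = (pairing q (e k))^-1 *: e k by rewrite {2}Ek scalerK.
by rewrite Ej Ec scalerA -scalemxAr mul_col !mxE (negPf jk) mulr0.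
Qed.

Section Facet.
Context (j : 'I_d.+1).
Context (Mej : M *m e j = 0).

Let row'_c : row' j C *m c = 0.
Proof.
have := Mej => /eqP; rewrite -facet_normalE => /eqP <-.
rewrite -scalemxAr row'_mul mul_col; apply/matrixP => a b; rewrite !mxE.
by rewrite eq_sym (negPf (neq_lift _ _)) mulr0.
Qed.

Lemma mul_facet m (A : 'M[R]_(d.+1, m)) : facet j *m (M *m A) = row' j (C *m A).
Proof.
rewrite -row'_mul /facet -[X in _ = _ *m X]mul1mx -(split_1 S) mulmxDl mulmxDr.
by rewrite -(mulmxA c) (mulmxA _ c) row'_c mul0mx add0r !mulmxA.
Qed.

Lemma facet_inv : facet j *m (M *m col' j (invmx C)) = 1%:M.
Proof.
rewrite mul_facet; apply/matrixP => a b.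
have -> : C *m col' j (invmx C) = col' j 1%:M.
  rewrite -(mulmxV uC); apply/matrixP => a' b'; rewrite !mxE.
  by apply: eq_bigr => i _; rewrite !mxE.
by rewrite !mxE (inj_eq lift_inj).
Qed.

Lemma facet_unit : facet j \in unitmx.
Proof. by case: (mulmx1_unit facet_inv). Qed.

Lemma normals_facet :
  normals (facet j) = [seq M *m e (lift j i) | i <- enum 'I_d].
Proof.
apply: eq_map => k.
rewrite -[invmx _]mulmx1 -facet_inv (mulKmx facet_unit).
apply/matrixP => a b; rewrite !mxE.
by apply: eq_bigr => i _; rewrite !mxE.
Qed.

Lemma det_facet : `|\det C| * `|pairing q (e j)|
  = `|\det (col_mx q M : 'M_(1 + d))| * `|\det (facet j)|.
Proof.
transitivity `|\det (col_mx q (row' j C) : 'M_(1 + d))|.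
  (* Laplace expansion along [q]: the cofactors are, up to sign, [\det C] times the entries of
     [e j]. *)
  have -> : \det (col_mx q (row' j C) : 'M_(1 + d)) =
      (-1) ^+ j * (\det C * pairing q (e j)).
    rewrite (expand_det_row _ (lshift d 0)) /pairing mxE !mulr_sumr.
    apply: eq_bigr => k _; rewrite col_mxEu (mulrCA (\det C)) (mulrCA (_ ^+ j)).
    congr (_ * _).
    rewrite mxE /invmx uC !mxE mulVKf -?unitfE -?unitmxE //.
    rewrite /cofactor mulrA -exprD addnA addnn -mul2n (exprD _ (2 * j)) exprM sqrrN
      expr1n expr1n mul1r.
    congr (_ * \det _); apply/matrixP => a b; rewrite !mxE.
    case: splitP => [i|i] /=; first by case: i => -[].
    by rewrite /bump /= !add1n => -[/val_inj ->]; rewrite !mxE.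
  by rewrite normrMsign normrM.
(* The same matrix factors as the block diagonal of [1] and [facet j], times [col_mx q M]. *)
rewrite mulrC -normrM -[\det (facet j)]mul1r -(det1 R 1) -(det_ublock _ 0).
rewrite -det_mulmx mul_block_col !mul0mx mul1mx addr0 add0r.
by have := mul_facet 1%:M; rewrite !mulmx1 => ->.
Qed.
End Facet.

(** At most one facet lies in the hyperplane of [c]. The indicator of the cone jumps exactly on it,
    with the sign telling on which side the cone lies. *)
Lemma jump_simplicial u :
  (@side R _ _ q M 1 (normals C) && dual_cone (map (mulmx M) (normals C)) u)%:R
  - (@side R _ _ q M (-1) (normals C)
     && dual_cone (map (mulmx M) (normals C)) u)%:R
  = \sum_(j | (pairing q (e j))^-1 *: e j == c)
      Num.sg (pairing q (e j)) * (dual_cone (normals (facet j)) u)%:R.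
Proof.
have [j /eqP Mej|M0] := pickP (fun j => M *m e j == 0); last first.
  rewrite big_pred0 => [|j]; last by rewrite facet_normalE M0.
  have side1 s : @side R _ _ q M s (normals C).
    by rewrite /side all_map; apply/allP => j _ /=; rewrite M0.
  by rewrite !side1 subrr.
rewrite (big_pred1 j) => [|k /=]; last first.
  rewrite facet_normalE; apply/eqP/eqP => [/facet_normal_inj H|-> //].
  exact: H.
have sideE s : @side R _ _ q M s (normals C) = (0 <= s * pairing q (e j)).
  rewrite /side all_map; apply/allP/idP => [/(_ j)|sj k _ /=].
    by rewrite mem_enum /= Mej eqxx => /(_ isT).
  by have [/eqP/(facet_normal_inj Mej) <-|//] := boolP (_ == 0).
have -> : dual_cone (normals (facet j)) u = dual_cone (map (mulmx M) (normals C)) u.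
  rewrite normals_facet // /dual_cone all_map all_enum all_map all_map all_enum.
  apply/forallP/forallP => H k /=; last exact: H.
  by have [i ->|->] := unliftP j k; [apply: H|rewrite Mej pairing0r].
rewrite !sideE mul1r mulN1r oppr_ge0.
case: ltrgt0P (qe j) => // h _; rewrite ?andbF ?andbT /=.
  by rewrite gtr0_sg // subr0 mul1r.
by rewrite ltr0_sg // sub0r mulN1r.
Qed.

End SimplicialCone.

(** * Additivity of cone weights *)

(** Serves to group facets by their hyperplane and cones by their vertex. *)
Lemma big_fibers0 (V : nmodType) (I J : eqType) (l : seq I) (h : I -> J)
    (F : I -> V) :
  (forall j, \sum_(i <- l | h i == j) F i = 0) -> \sum_(i <- l) F i = 0.
Proof.
move=> H; pose s := undup (map h l).
rewrite (eq_big_seq (fun i => \sum_(j <- s) if h i == j then F i else 0)).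
  by rewrite exchange_big big1 // => j _; rewrite -big_mkcond.
move=> i il; have hs : h i \in s by rewrite mem_undup map_f.
rewrite (bigD1_seq (h i)) ?undup_uniq //= eqxx big1 ?addr0 // => j.
by rewrite eq_sym => /negPf ->.
Qed.

Lemma normal_neq0 (R : fieldType) d (C : 'M[R]_d) j :
  C \in unitmx -> col j (invmx C) != 0.
Proof.
move=> uC; apply/negP => /eqP e0.
have : (C *m invmx C) j j = 1 by rewrite mulmxV // mxE eqxx.
rewrite mxE big1 => [/eqP|k _]; first by rewrite eq_sym oner_eq0.
by have /matrixP/(_ k 0) := e0; rewrite !mxE => ->; rewrite mulr0.
Qed.

Section ConeRelations.
Context {R : realFieldType} {n d : nat} {q : 'rV[R]_n} {c : 'cV[R]_n}
  {M : 'M[R]_(d, n)} {L : 'M[R]_(n, d)} (S : splitting q c M L).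
Implicit Types (K : seq (R * seq 'cV[R]_n)).

(** Evaluate the relation at [c] and at [- c], each moved slightly by a lift of [y], and subtract.
    Near each of these points the cones become their quotients; the condition on [y] keeps the moved
    points generic. *)
Lemma in_cone_relation_quotient K (B : seq 'rV[R]_n) :
  (forall y, (forall b, b \in B -> pairing b y != 0) ->
    \sum_(k <- K) k.1 * `[< in_cone k.2 y >]%:R = 0) ->
  forall y, (forall b, b \in B -> pairing b c = 0 -> pairing (b *m L) y != 0) ->
  \sum_(k <- K) k.1 * (`[< in_cone k.2 c >]%:R - `[< in_cone k.2 (- c) >]%:R)
    * `[< in_cone (map (mulmx M) k.2) y >]%:R = 0.
Proof.
move=> HK y yB.
have half c' : c' = c \/ c' = - c -> \sum_(k <- K) k.1 *
    (`[< in_cone k.2 c' >]%:R * `[< in_cone (map (mulmx M) k.2) y >]%:R) = 0.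
  move=> cc'.
  have Mc' : M *m c' = 0 by case: cc' => ->; rewrite ?mulmxN (split_Mc S) ?oppr0.
  have kerM z : M *m z = 0 -> exists t, z = t *: c'.
    move=> /(splitting_ker S) ->.
    case: cc' => ->; first by exists (pairing q z).
    by exists (- pairing q z); rewrite scalerN scaleNr opprK.
  have [||e e0 [H1 H2]] := small_ex (@small_and _
      (fun e => forall b, b \in B -> pairing b c' + e * pairing b (L *m y) != 0)
      (fun e => forall k, k \in K -> in_cone k.2 (c' + e *: (L *m y)) <->
          in_cone k.2 c' /\ in_cone (map (mulmx M) k.2) (M *m (L *m y))) _ _).
  - apply: small_all => b bB; apply: small_neq0; rewrite -implyNb negbK.
    apply/implyP => /eqP bc; rewrite pairing_mulmx yB //.
    by case: cc' bc => ->; rewrite ?pairingNr // => /eqP; rewrite oppr_eq0 => /eqP.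
  - by apply: small_all => k _; apply: in_cone_small.
  rewrite -[RHS](HK (c' + e *: (L *m y))) => [|b bB]; last first.
    by rewrite pairingDr pairingZr H1.
  apply: eq_big_seq => k kK; rewrite (asbool_equiv_eq (H2 k kK)) asbool_and.
  by rewrite mulmxA (split_ML S) mul1mx -natrM mulnb.
rewrite -[RHS](subr0 0) -[X in _ = X - _](half c (or_introl erefl)).
rewrite -[X in _ = _ - X](half (- c) (or_intror erefl)) -sumrB.
by apply: eq_bigr => k _; rewrite -mulrBr -mulrBl mulrA.
Qed.

End ConeRelations.

Section FacetRelation.
Context {R : realFieldType} {d : nat} {q : 'rV[R]_d.+1} {c : 'cV[R]_d.+1}
  {M : 'M[R]_(d, d.+1)} {L : 'M[R]_(d.+1, d)} (S : splitting q c M L).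

(** Subtract the relation at two forms close to [u *m M], on opposite sides of the hyperplane of
    [c]. The left side jumps by facets, the right side by duals of quotients. *)
Lemma facet_relation (T : seq (R * 'M[R]_d.+1)) (K : seq (R * seq 'cV[R]_d.+1))
    (B : seq 'cV[R]_d.+1) :
  (forall s, s \in T -> s.2 \in unitmx) ->
  (forall s j, s \in T -> pairing q (col j (invmx s.2)) != 0) ->
  (forall b, b \in B -> b != 0) ->
  (forall v, (forall b, b \in B -> pairing v b != 0) ->
    \sum_(s <- T) s.1 * (dual_cone (normals s.2) v)%:R
    = \sum_(k <- K) k.1 * (dual_cone k.2 v)%:R) ->
  forall u, avoids (M := M) u B ->
  (forall s, s \in T -> avoids (M := M) u (normals s.2)) ->
  (forall k, k \in K -> avoids (M := M) u k.2) ->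
  \sum_(s <- T) s.1 *
     \sum_(j | (pairing q (col j (invmx s.2)))^-1 *: col j (invmx s.2) == c)
      Num.sg (pairing q (col j (invmx s.2)))
      * (dual_cone (normals (@facet R d L s.2 j)) u)%:R
  = \sum_(k <- K) k.1 * (`[< in_cone k.2 c >]%:R - `[< in_cone k.2 (- c) >]%:R)
    * (dual_cone (map (mulmx M) k.2) u)%:R.
Proof.
move=> uT qT B0 HT u uB uTn uK.
have [e e0 [[H1 H2] H3]] : exists2 e, 0 < e & ((forall G,
    G \in map snd K ++ [seq normals s.2 | s <- T] ->
    dual_cone G (u *m M + e *: (1 *: q)) =
      @side R _ _ q M 1 G && dual_cone (map (mulmx M) G) u) /\
  (forall G, G \in map snd K ++ [seq normals s.2 | s <- T] ->
    dual_cone G (u *m M + e *: (-1 *: q)) =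
      @side R _ _ q M (-1) G && dual_cone (map (mulmx M) G) u)) /\
  forall b, b \in B -> pairing (u *m M + e *: (1 *: q)) b != 0 /\
    pairing (u *m M + e *: (-1 *: q)) b != 0.
  have avG G : G \in map snd K ++ [seq normals s.2 | s <- T] -> avoids (M := M) u G.
    by rewrite mem_cat => /orP[] /mapP[x xT ->]; [apply: uK | apply: uTn].
  apply: small_ex; apply: small_and.
    by apply: small_and; apply: small_all => G /avG; apply: dual_cone_side.
  have sb b s : b \in B -> s != 0 ->
      small (fun e => pairing (u *m M + e *: (s *: q)) b != 0).
    move=> bB s0; apply: small_imp
      (@small_neq0 _ (pairing u (M *m b)) (s * pairing q b) _).
      by move=> e _; rewrite pairingDl !pairingZl pairing_mulmx.
    rewrite mulf_eq0 (negPf s0) /=.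
    have [/(splitting_ker S) bE|Mb] := eqVneq (M *m b) 0; last by rewrite uB.
    by apply/orP; right; apply: contraNneq (B0 _ bB) => E; rewrite bE E scale0r.
  apply: small_all => b bB; apply: small_and; apply: sb => //.
    exact: oner_neq0.
  by rewrite oppr_eq0 oner_neq0.
have HT1 := HT _ (fun b bB => (H3 b bB).1).
have HT2 := HT _ (fun b bB => (H3 b bB).2).
transitivity (\sum_(s <- T)
    s.1 * (dual_cone (normals s.2) (u *m M + e *: (1 *: q)))%:R
  - \sum_(s <- T) s.1 * (dual_cone (normals s.2) (u *m M + e *: (-1 *: q)))%:R).
  rewrite -sumrB; apply: eq_big_seq => s sT; rewrite -mulrBr; congr (_ * _).
  rewrite -(jump_simplicial S) ?uT // => [|j]; last exact: qT.
  have memT : normals s.2 \in map snd K ++ [seq normals s.2 | s <- T].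
    by rewrite mem_cat; apply/orP; right; apply/mapP; exists s.
  by rewrite -H1 // -H2.
rewrite HT1 HT2 -sumrB; apply: eq_big_seq => k kK.
rewrite -mulrBr -mulrA -(jump_in_cone S (uK k kK)).
have memK : k.2 \in map snd K ++ [seq normals s.2 | s <- T].
  by rewrite mem_cat map_f.
by rewrite -H1 // -H2.
Qed.

End FacetRelation.

(* The rational function of [w] that a cone with the rows of [C] as generators
   contributes: the integral of [exp (- <v, w>)] over it, where that converges. *)
Definition cone_weight (R : realFieldType) d (C : 'M[R]_d) (w : 'cV[R]_d) : R :=
  `|\det C| / \prod_k (C *m w) k 0.

(** Expanding [w] in the columns of [invmx C] has coefficients [(C *m w) j 0], and each cancels one
    factor of the denominator. *)
Lemma cone_weight_facets (R : realFieldType) d (C : 'M[R]_d.+1) q w :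
  C \in unitmx -> (forall k, (C *m w) k 0 != 0) ->
  pairing q w * cone_weight C w =
  \sum_j `|\det C| * pairing q (col j (invmx C))
           / \prod_k (C *m w) (lift j k) 0.
Proof.
move=> uC Cw.
have -> : pairing q w = \sum_j pairing q (col j (invmx C)) * (C *m w) j 0.
  rewrite -[w in LHS](mulKmx uC) pairing_mulmx {1}/pairing mxE.
  by apply: eq_bigr => j _; rewrite pairing_col.
rewrite mulr_suml; apply: eq_bigr => j _; rewrite /cone_weight (bigD1_ord j) //=.
set p := \prod_k _; have := Cw j; set x := (C *m w) j 0 => x0.
have p0 : p != 0 by apply/prodf_neq0.
by field; rewrite x0 p0.
Qed.

(** [B] and [B'] collect the exceptional hyperplanes on the dual and on the primal side. The
    simplicial cones [T] need only agree with the duals of [K] as weighted sums of indicators. *)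
Theorem cone_weight_sum_eq0 (R : realFieldType) d (w : 'cV[R]_d)
    (T : seq (R * 'M[R]_d)) (K : seq (R * seq 'cV[R]_d))
    (B : seq 'cV[R]_d) (B' : seq 'rV[R]_d) :
  (forall s, s \in T -> s.2 \in unitmx) ->
  (forall s k, s \in T -> (s.2 *m w) k 0 != 0) ->
  (forall b, b \in B -> b != 0) -> (forall b, b \in B' -> b != 0) ->
  (forall v, (forall b, b \in B -> pairing v b != 0) ->
    \sum_(s <- T) s.1 * (dual_cone (normals s.2) v)%:R
    = \sum_(k <- K) k.1 * (dual_cone k.2 v)%:R) ->
  (forall y, (forall b, b \in B' -> pairing b y != 0) ->
    \sum_(k <- K) k.1 * `[< in_cone k.2 y >]%:R = 0) ->
  \sum_(s <- T) s.1 * cone_weight s.2 w = 0.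
Proof.
elim: d => [|d IH] in w T K B B' *.
  move=> _ _ B0 B'0 HT HK.
  have BB v : forall b, b \in B -> pairing v b != 0.
    by move=> b /B0; rewrite flatmx0 eqxx.
  have BB' y : forall b, b \in B' -> pairing b y != 0.
    by move=> b /B'0; rewrite thinmx0 eqxx.
  (* In dimension 0 all weights and all indicators are 1, so both relations speak of plain sums of
     coefficients. *)
  transitivity (\sum_(s <- T) s.1 * (dual_cone (normals s.2) 0)%:R).
    apply: eq_bigr => s _; rewrite /cone_weight det_mx00 big_ord0 divr1 normr1.
    by rewrite /dual_cone all_map all_enum; case: forallP => // -[] [].
  rewrite (HT _ (BB _)) -[RHS](HK 0 (BB' _)); apply: eq_bigr => k _.
  have -> : `[< in_cone k.2 0 >] by apply/asboolP; apply: in_cone0.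
  suff -> : dual_cone k.2 0 by [].
  by apply/allP => g _; rewrite (flatmx0 g) pairing0r.
move=> uT wT B0 B'0 HT HK.
have [->|Tn0] := eqVneq T [::]; first by rewrite big_nil.
have w0 : w != 0.
  case: T Tn0 wT {uT HT} => // s T _ /(_ s ord0 (mem_head _ _)).
  by apply: contraNneq => ->; rewrite mulmx0 mxE.
have [|q q00 qB] := @generic_row R d (w :: flatten [seq normals s.2 | s <- T]).
  move=> g; rewrite inE => /predU1P[-> //|/flatten_mapP[s sT /mapP[j _ ->]]].
  exact/normal_neq0/uT.
have qw : pairing q w != 0 by apply: qB; rewrite mem_head.
have qT s j : s \in T -> pairing q (col j (invmx s.2)) != 0.
  move=> sT; apply: qB; rewrite inE; apply/orP; right.
  by apply/flatten_mapP; exists s => //; apply/map_f/mem_enum.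
apply/eqP; rewrite -(mulrI_eq0 _ (mulfI qw)) mulr_sumr; apply/eqP.
pose items := [seq (s, j) | s <- T, j <- enum 'I_d.+1].
pose e (x : R * 'M[R]_d.+1 * 'I_d.+1) := col x.2 (invmx x.1.2).
pose F x := x.1.1 * (`|\det x.1.2| * pairing q (e x)
           / \prod_k (x.1.2 *m w) (lift x.2 k) 0).
transitivity (\sum_(x <- items) F x).
  rewrite big_allpairs_dep; apply: eq_big_seq => s sT.
  rewrite mulrCA cone_weight_facets ?uT // => [|k]; last exact: wT.
  by rewrite mulr_sumr big_enum.
have itemsP x : x \in items -> x.1 \in T.
  by case/allpairsP => -[s j] /= [sT _ ->].
(* Normals scaled to value 1 under [q] coincide exactly when the facets span the same hyperplane. *)
apply: (@big_fibers0 _ _ _ _ (fun x => (pairing q (e x))^-1 *: e x)) => c.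
have [qc|qc] := eqVneq (pairing q c) 1; last first.
  rewrite big_seq_cond big1 // => x /andP[/itemsP xT /eqP cx].
  by case/eqP: qc; rewrite -cx pairingZr mulVf // qT.
have [M [L S]] := ex_splitting q00 qc.
have Mx x : x \in items -> (pairing q (e x))^-1 *: e x == c -> M *m e x = 0.
  by move=> /itemsP xT; rewrite (facet_normalE S) => [/eqP|j]; last exact: qT.
pose T' := [seq (x.1.1 * Num.sg (pairing q (e x)), @facet R d L x.1.2 x.2)
           | x <- items & (pairing q (e x))^-1 *: e x == c].
have T'P s : s \in T' -> exists x, [/\ x \in items, M *m e x = 0 &
     s = (x.1.1 * Num.sg (pairing q (e x)), @facet R d L x.1.2 x.2)].
  case/mapP => x; rewrite mem_filter => /andP[cx xi] ->.
  by exists x; split => //; apply: Mx.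
pose K' := [seq (k.1 * (`[< in_cone k.2 c >]%:R - `[< in_cone k.2 (- c) >]%:R),
                 map (mulmx M) k.2) | k <- K].
pose allB := flatten [seq normals s.2 | s <- T] ++ flatten (map snd K) ++ B.
(* Up to this common factor, the terms of one hyperplane are the weights of the facets at the
   projection of [w], one dimension lower. *)
transitivity (`|\det (col_mx q M : 'M_(1 + d))| *
              \sum_(s <- T') s.1 * cone_weight s.2 (M *m w)).
  rewrite big_map big_filter mulr_sumr big_seq_cond [RHS]big_seq_cond.
  apply: eq_bigr => x /andP[xi /(Mx _ xi) Mex] /=.
  have xT := itemsP _ xi.
  rewrite /F /cone_weight (mul_facet S (uT _ xT)) //; last by move=> j; apply: qT.
  under [in RHS]eq_bigr do rewrite mxE.
  have := det_facet S (uT _ xT) (fun j => qT _ j xT) Mex.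
  set dt := `|\det (facet _ _)|; set N := `|\det (col_mx _ _)| => E.
  have -> : `|\det x.1.2| * pairing q (e x) = Num.sg (pairing q (e x)) * (N * dt).
    by rewrite -E mulrCA -numEsg.
  by ring.
(* Exceptional hyperplanes below: the nonzero images of all dual-side vectors, and those forms of
   [B'] that vanish on [c] and so descend to the quotient. *)
rewrite (IH _ T' K' [seq b <- map (mulmx M) allB | b != 0]
  [seq b *m L | b <- B' & pairing b c == 0]) ?mulr0 //.
- move=> s /T'P [x [xi Mex ->]] /=.
  by apply: (facet_unit S); rewrite ?uT ?itemsP // => j; apply/qT/itemsP.
- move=> s k /T'P [x [xi Mex ->]] /=; have xT := itemsP _ xi.
  rewrite (mul_facet S (uT _ xT)) //; last by move=> j; apply: qT.
  by rewrite mxE wT.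
- by move=> b; rewrite mem_filter => /andP[].
- move=> _ /mapP[b + ->]; rewrite mem_filter => /andP[/eqP bc bB].
  apply: contraNneq (B'0 _ bB) => bL.
  rewrite -[b]mulmx1 -(split_1 S) mulmxDr !mulmxA bL mul0mx addr0.
  by rewrite [b *m c]mx11_scalar -/(pairing b c) bc raddf0 mul0mx.
- move=> u uB.
  have av G : {subset G <= allB} -> avoids (M := M) u G.
    by move=> GB g gG Mg; apply: uB; rewrite mem_filter Mg map_f // GB.
  rewrite !big_map big_filter big_mkcond big_allpairs_dep /=.
  rewrite -(facet_relation S uT qT B0 HT) //.
  + apply: eq_bigr => s _; rewrite -big_mkcond big_enum_cond /= mulr_sumr.
    by apply: eq_bigr => j _; rewrite mulrA.
  + by apply: av => b bB; rewrite !mem_cat bB !orbT.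
  + move=> s sT; apply: av => b bs; rewrite mem_cat; apply/orP; left.
    by apply/flatten_mapP; exists s.
  + move=> k kK; apply: av => b bk; rewrite !mem_cat; apply/orP; right.
    by apply/orP; left; apply/flatten_mapP; exists k.
- move=> y yB; rewrite big_map /=.
  apply: (in_cone_relation_quotient S HK) => b bB bc.
  by apply: yB; apply/map_f; rewrite mem_filter bc eqxx.
Qed.

(** * Polytopes *)

Local Open Scope classical_set_scope.
Local Open Scope ring_scope.

Section Dot.
Context {R : realType} {d : nat}.
Implicit Types (u v x y : 'rV[R]_d).

Lemma dotE v y : dot v y = pairing v y^T.
Proof. by rewrite /dot /pairing mxE; apply: eq_bigr => k _; rewrite mxE. Qed.

Lemma dotC v y : dot v y = dot y v.
Proof. by apply: eq_bigr => k _; rewrite mulrC. Qed.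

Lemma dotDr v x y : dot v (x + y) = dot v x + dot v y.
Proof. by rewrite !dotE linearD pairingDr. Qed.

Lemma dotNr v y : dot v (- y) = - dot v y.
Proof. by rewrite !dotE linearN pairingNr. Qed.

Lemma dotBr v x y : dot v (x - y) = dot v x - dot v y.
Proof. by rewrite dotDr dotNr. Qed.

Lemma dotZr a v y : dot v (a *: y) = a * dot v y.
Proof. by rewrite !dotE linearZ pairingZr. Qed.

Lemma dot0r v : dot v 0 = 0.
Proof. by rewrite -(scale0r 0) dotZr mul0r. Qed.

Lemma dot0l y : dot 0 y = 0.
Proof. by rewrite dotC dot0r. Qed.

Lemma dot_sumr I (l : seq I) (P : pred I) (F : I -> 'rV[R]_d) v :
  dot v (\sum_(i <- l | P i) F i) = \sum_(i <- l | P i) dot v (F i).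
Proof. by apply: (big_morph (dot v)); [apply: dotDr | apply: dot0r]. Qed.

Lemma dotvv_eq0 v : (dot v v == 0) = (v == 0).
Proof.
apply/eqP/eqP => [|->]; last exact: dot0r.
move/psumr_eq0P => H; apply/rowP => k; rewrite mxE; apply/eqP.
by rewrite -sqrf_eq0 expr2 H // => i _; rewrite -expr2 sqr_ge0.
Qed.

End Dot.

Section ConvexHull.
Context {R : realType} {d : nat}.
Implicit Types (u v x y : 'rV[R]_d) (A B : set 'rV[R]_d) (V : seq 'rV[R]_d).

Lemma sub_conv_hull A : A `<=` conv_hull A.
Proof.
move=> y Ay; exists 1%N, (fun=> 1), (fun=> y); split=> //.
  by rewrite big_ord1.
by rewrite big_ord1 scale1r.
Qed.

Lemma conv_hullS A B : A `<=` B -> conv_hull A `<=` conv_hull B.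
Proof.
move=> AB y [k [w [p [w0 w1 Ap ->]]]].
by exists k, w, p; split=> // j; apply/AB/Ap.
Qed.

Lemma conv_hull_convex A x y t : 0 <= t <= 1 ->
  conv_hull A x -> conv_hull A y -> conv_hull A ((1 - t) *: x + t *: y).
Proof.
move=> /andP[t0 t1] [k [w [p [w0 w1 Ap ->]]]] [k' [w' [p' [w'0 w'1 Ap' ->]]]].
exists (k + k')%N,
  (fun j => match fintype.split j with inl i => (1 - t) * w i | inr i => t * w' i end),
  (fun j => match fintype.split j with inl i => p i | inr i => p' i end).
have sl i : fintype.split (lshift k' i) = inl i by apply: (unsplitK (inl i)).
have sr i : fintype.split (rshift k i) = inr i by apply: (unsplitK (inr i)).
split.
- by move=> j; case: fintype.split => i; rewrite mulr_ge0 // subr_ge0.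
- rewrite big_split_ord /=; under eq_bigr do rewrite sl.
  under [X in _ + X]eq_bigr do rewrite sr.
  by rewrite -!mulr_sumr w1 w'1 !mulr1 subrK.
- by move=> j; case: fintype.split.
rewrite big_split_ord /= !scaler_sumr; congr (_ + _); apply: eq_bigr => i _.
  by rewrite sl scalerA.
by rewrite sr scalerA.
Qed.

Lemma dot_conv_hull_ge A v a y :
  (forall p, A p -> a <= dot v p) -> conv_hull A y -> a <= dot v y.
Proof.
move=> Aa [k [w [p [w0 w1 Ap ->]]]]; rewrite dot_sumr -[a]mul1r -w1 mulr_suml.
by apply: ler_sum => j _; rewrite dotZr ler_wpM2l // Aa.
Qed.

Lemma in_cone_mapP (I : Type) (i0 : I) (f : I -> 'cV[R]_d) (l : seq I)
    (y : 'cV[R]_d) :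
  in_cone (map f l) y ->
  exists2 w : 'I_(size l) -> R, forall i, 0 <= w i &
    y = \sum_i w i *: f (nth i0 l i).
Proof.
elim: l y => [|a l IH] y /=; first by move=> ->; exists (fun=> 0); rewrite ?big_ord0.
move=> [t t0 /IH[w w0 E]].
exists (fun i => oapp w t (unlift ord0 i)) => [i|].
  by case: unliftP => [j|] _ //=.
rewrite big_ord_recl unlift_none /= -[LHS](subrK (t *: f a)) addrC E.
by congr (_ + _); apply: eq_bigr => i _; rewrite liftK.
Qed.

Lemma in_cone_sum (G : seq 'cV[R]_d) (I : Type) (l : seq I) (F : I -> 'cV[R]_d) :
  (forall i, in_cone G (F i)) ->
  in_cone G (\sum_(i <- l) F i).
Proof.
by move=> GF; elim/big_ind: _ => //; [apply: in_cone0 | apply: in_coneD].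
Qed.

End ConvexHull.

(** Farkas for the points lifted to height 1; the first entry of the separating form becomes the
    threshold [a]. *)
Lemma separation (R : realType) d (V : seq 'rV[R]_d) y :
  ~ conv_hull [set` V] y ->
  exists v a, dot v y < a /\ forall x, conv_hull [set` V] x -> a <= dot v x.
Proof.
move=> yV; pose lft (p : 'rV[R]_d) : 'cV[R]_(1 + d) := col_mx 1%:M p^T.
have [|v Vv vy] := @farkas R _ (map lft V) (lft y).
  move=> /(in_cone_mapP 0)[w w0].
  have -> : \sum_i w i *: lft V`_i =
      col_mx (\sum_i w i)%:M (\sum_i w i *: V`_i)^T.
    rewrite linear_sum raddf_sum; elim/big_rec3: _ => [|i a b c _ ->].
      by rewrite col_mx0.
    by rewrite scale_col_mx add_col_mx linearZ scale_scalar_mx mulr1.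
  move=> /eq_col_mx[/matrixP/(_ 0 0) w1 /trmx_inj yE].
  apply: yV; exists (size V), w, (fun i => V`_i); split=> // [|i].
    by move: w1; rewrite !mxE eqxx !mulr1n.
  by rewrite /= mem_nth.
have vlft p : pairing v (lft p) = v 0 0 + dot (rsubmx v) p.
  rewrite dotE /pairing -[v in LHS]hsubmxK mul_row_col mulmx1 !mxE.
  by congr (v _ _ + _); apply: val_inj.
exists (rsubmx v), (- v 0 0); split; first by move: vy; rewrite vlft; lra.
move=> x; apply: dot_conv_hull_ge => p pV.
by move/allP: Vv => /(_ _ (map_f lft pV)); rewrite /= vlft; lra.
Qed.

Section PolytopeTheory.
Context {R : realType} {d : nat}.
Implicit Types (u v x y : 'rV[R]_d) (A F : set 'rV[R]_d) (V : seq 'rV[R]_d).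

Definition minimizes A v y := A y /\ forall y', A y' -> dot v y <= dot v y'.

Lemma seq_minimizer V v : V != [::] ->
  exists2 p, p \in V & minimizes (conv_hull [set` V]) v p.
Proof.
move=> V0; suff [p pV minp] : exists2 p, p \in V &
    forall p', p' \in V -> dot v p <= dot v p'.
  exists p => //; split=> [|y]; first by apply: sub_conv_hull.
  exact: dot_conv_hull_ge.
elim: V V0 => // a [_ _|b V /(_ isT)[p pV minp] _].
  by exists a => [|p']; rewrite inE // => /eqP ->.
have [ap|pa] := leP (dot v a) (dot v p).
  exists a => [|p']; first exact: mem_head.
  by rewrite inE => /predU1P[->|/minp]; last exact: le_trans.
exists p => [|p']; first by rewrite inE pV orbT.
by rewrite inE => /predU1P[->|/minp//]; apply: ltW.
Qed.

Lemma polytope_minimizer A : is_polytope A -> forall v, exists y, minimizes A v y.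
Proof. by move=> [V V0 ->] v; have [p _ ?] := seq_minimizer v V0; exists p. Qed.

Lemma support_funE A v y : minimizes A v y -> support_fun A v = - dot v y.
Proof.
move=> [Ay miny]; congr (- _); apply/eqP; rewrite eq_le; apply/andP; split.
  by apply: ge_inf; [exists (dot v y) => _ [y' /miny ? <-] | exists y].
by apply: lb_le_inf; [exists (dot v y), y | move=> _ [y' /miny ? <-]].
Qed.

Lemma support_fun_minimizes A v y :
  is_polytope A -> A y -> support_fun A v = - dot v y -> minimizes A v y.
Proof.
move=> /polytope_minimizer /(_ v)[x /[dup] xA /support_funE -> Ay].
by move=> /oppr_inj E; split=> // y' /xA.2; rewrite E.
Qed.

Lemma minimizer_face A v : is_face [set x | minimizes A v x] A /\
  normal_cone A [set x | minimizes A v x] v.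
Proof. by split=> [|x /support_funE //]; right; exists v. Qed.

(** The form exposing the face is constant on it, and is nonzero because the zero form exposes all
    of [A]. *)
Lemma proper_face_normal A F x : is_proper_face F A -> F x ->
  exists2 h, h != 0 & forall y, F y -> dot h (y - x) = 0.
Proof.
move=> [[-> //|[h ->]] FA] [Ax minx]; exists h => [|y [Ay miny]].
  apply: contra_notN FA => /eqP ->; apply/seteqP; split=> [y []//|y Ay].
  by split=> // y' _; rewrite !dot0l.
by rewrite dotBr; apply/eqP; rewrite subr_eq0 eq_le minx // miny.
Qed.

End PolytopeTheory.

(** The generators are all sums of one listed point per summand. They reach the minimum of every
    linear form, so separation leaves no other point of the sum outside their hull. *)
Lemma minkowski_sum_polytope (R : realType) d r (P : 'I_r -> set 'rV[R]_d) :
  (forall i, is_polytope (P i)) -> is_polytope (minkowski_sum P).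
Proof.
move=> /(_ _)/cid2 Ps; pose s i := sval (Ps i).
have s0 i : s i != [::] by rewrite /s; case: (Ps i).
have PE i : P i = conv_hull [set` s i] by rewrite /s; case: (Ps i).
(* One index type large enough for all lists makes the choices a finite type; indices out of range
   fall back to the head of the list. *)
pose pt (f : {ffun 'I_r -> 'I_(\sum_i size (s i))}) i :=
  nth (head 0 (s i)) (s i) (f i).
have pt_s f i : pt f i \in s i.
  have := s0 i; rewrite /pt; case: (s i) => //= a l _.
  have [lt|ge] := ltnP (f i) (size (a :: l)); first exact: mem_nth.
  by rewrite nth_default // mem_head.
have ptP p : (forall i, p i \in s i) -> exists f, pt f = p.
  move=> ps.
  have lt i : (index (p i) (s i) < \sum_i size (s i))%N.
    by rewrite (bigD1 i) //= ltn_addr // index_mem.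
  exists [ffun i => Ordinal (lt i)]; apply/funext => i.
  by rewrite /pt ffunE /= nth_index.
pose V := [seq \sum_i pt f i | f : {ffun 'I_r -> 'I_(\sum_i size (s i))}].
have minV v : exists2 p, p \in V & forall y, minkowski_sum P y -> dot v p <= dot v y.
  have ex i : exists p, p \in s i /\ minimizes (P i) v p.
    by have [p ps minp] := seq_minimizer v (s0 i); exists p; rewrite PE.
  have [p pP] := choice ex.
  have [|f fp] := ptP p; first by move=> i; case: (pP i).
  exists (\sum_i p i); first by rewrite -fp; apply/map_f/mem_enum.
  move=> _ [y yP <-]; rewrite !dot_sumr; apply: ler_sum => i _.
  by case: (pP i) => _ [_]; apply.
exists V; first by case: (minV 0) => p; case: (V).
apply/seteqP; split=> y.
  move=> Py; apply: contrapT => /separation[v [a [ya aV]]].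
  have [p pV /(_ _ Py)] := minV v.
  by rewrite leNgt (lt_le_trans ya) // aV //; apply: sub_conv_hull.
move=> [k [w [p [w0 w1 pV ->]]]].
have [|f fp] := @choice _ _ (fun j f => p j = \sum_i pt f i).
  by move=> j; case/mapP: (pV j) => f _ ->; exists f.
exists (fun i => \sum_j w j *: pt (f j) i) => [i|].
  rewrite PE; exists k, w, (fun j => pt (f j) i); split=> // j.
  exact: pt_s.
rewrite exchange_big; apply: eq_bigr => j _.
by rewrite fp scaler_sumr.
Qed.

(** Every vertex of [P i] is a listed point, since some listed point minimizes the form exposing it.
    Full dimension of the sum makes each [Q i] nonempty. *)
Lemma minkowski_cell_polytope (R : realType) d r (P Q : 'I_r -> set 'rV[R]_d) :
  (forall i, is_polytope (P i)) -> is_minkowski_cell P Q ->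
  forall i, is_polytope (Q i) /\ Q i `<=` P i.
Proof.
move=> Pp [QP fullQ] i; have [A AP QE] := QP i; have [s s0 PE] := Pp i.
have As y : A y -> y \in s.
  move=> /AP [|[v vE]]; first by move=> /seteqP[/(_ y erefl)].
  have [p ps minp] := seq_minimizer v s0; rewrite -PE in minp.
  by have -> : y = p by symmetry; have : [set y] p by rewrite vE.
have AE : A = [set` [seq y <- s | `[< A y >]]].
  apply/seteqP; split=> y /=; rewrite mem_filter; last by case/andP => /asboolP.
  by move=> Ay; rewrite As // andbT; apply/asboolP.
split; last by rewrite QE PE; apply: conv_hullS => y /As.
exists [seq y <- s | `[< A y >]]; last by rewrite -AE.
have [y Qy] : exists y, Q i y.
  have : affine_hull (minkowski_sum Q) 0 by rewrite fullQ.
  move=> [[|k] [w [p [w1 pQ _]]]].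
    by move: w1; rewrite big_ord0 => /eqP; rewrite eq_sym oner_eq0.
  by have [y yQ _] := pQ ord0; exists (y i).
move: Qy; rewrite QE => -[[|k] [w [p [_ w1 pA _]]]].
  by move: w1; rewrite big_ord0 => /eqP; rewrite eq_sym oner_eq0.
have := pA ord0; rewrite {1}AE /= => h.
by apply: contraTneq h => ->.
Qed.

(** * Tangent cones of polytopes *)

Section TangentCone.
Context {R : realType} {d : nat} (V : seq 'rV[R]_d) (A : set 'rV[R]_d).
Context (AE : A = conv_hull [set` V]).
Implicit Types (u v x y : 'rV[R]_d).

Definition tangent y := [seq (p - y)^T | p <- V].

Lemma dual_cone_tangent y v :
  A y -> dual_cone (tangent y) v <-> minimizes A v y.
Proof.
move=> Ay; split=> [/allP H|[_ miny]].
  split=> // x; rewrite AE; apply: dot_conv_hull_ge => p pV.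
  have /H : (p - y)^T \in tangent y by apply/map_f.
  by rewrite -dotE dotBr subr_ge0.
apply/allP => _ /mapP[p pV ->]; rewrite -dotE dotBr subr_ge0 miny // AE.
exact: sub_conv_hull.
Qed.

Lemma tangentP y u : A y -> in_cone (tangent y) u^T -> small (fun e => A (y + e *: u)).
Proof.
move=> Ay; rewrite /tangent.
have scale x l : 0 <= l -> small (fun e => A (y + e *: x)) ->
    small (fun e => A (y + e *: (l *: x))).
  move=> + [e e0 He]; rewrite le_eqVlt => /predU1P[<-|l0].
    by exists 1 => // t _; rewrite scale0r scaler0 addr0.
  exists (e / l); first exact: divr_gt0.
  move=> t /andP[t0 te]; rewrite scalerA; apply: He.
  by rewrite mulr_gt0 //= -ltr_pdivlMr.
have add x x' : small (fun e => A (y + e *: x)) -> small (fun e => A (y + e *: x')) ->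
    small (fun e => A (y + e *: (x + x'))).
  (* The target is the midpoint of the points reached along [2 *: x] and [2 *: x']. *)
  move=> /(@scale x 2 (ler0n _ 2)) sx /(@scale x' 2 (ler0n _ 2)) sx'.
  apply: small_imp (small_and sx sx') => e e0; rewrite AE => -[h h'].
  have h01 : 0 <= (2^-1 : R) <= 1 by lra.
  have := conv_hull_convex h01 h h'.
  rewrite (_ : (1 - _) *: _ + _ = y + e *: (x + x')) //.
  by apply/rowP => k; rewrite !mxE; field.
have pV p : p \in V -> small (fun e => A (y + e *: (p - y))).
  move=> pV; exists 1 => // e /andP[e0 e1]; rewrite AE.
  rewrite (_ : y + _ = (1 - e) *: y + e *: p).
    apply: conv_hull_convex; [lra | by rewrite -AE | exact: sub_conv_hull].
  by apply/rowP => k; rewrite !mxE; ring.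
suff gen W : {subset W <= V} -> forall x, in_cone [seq (p - y)^T | p <- W] x^T ->
    small (fun e => A (y + e *: x)) by apply: gen.
elim: W => [|p l IH] lV x /=.
  move=> /(canRL (@trmxK _ _ _)); rewrite trmx0 => ->.
  by exists 1 => // e _; rewrite scaler0 addr0.
move=> [t t0]; rewrite -linearZ -linearB => h.
rewrite -(subrK (t *: (p - y)) x); apply: add.
  by apply: IH h => p' p'l; apply: lV; rewrite inE p'l orbT.
by apply: scale => //; apply/pV/lV; rewrite mem_head.
Qed.

Lemma in_cone_tangent y u e : 0 < e -> A (y + e *: u) -> in_cone (tangent y) u^T.
Proof.
move=> e0; rewrite AE => -[k [w [p [w0 w1 pV E]]]].
have -> : u = e^-1 *: \sum_j w j *: (p j - y).
  under eq_bigr do rewrite scalerBr.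
  rewrite sumrB -E -scaler_suml w1 scale1r addrC addKr scalerK //.
  by rewrite gt_eqF.
rewrite linearZ; apply: in_coneZ; first by rewrite invr_ge0 ltW.
rewrite linear_sum; apply: in_cone_sum => j; rewrite linearZ.
by apply: in_coneZ => //; apply/mem_in_cone/map_f/pV.
Qed.

Lemma small_tangent y u : small (fun e =>
  A (y + e *: u) <-> A y /\ in_cone (tangent y) u^T).
Proof.
have [Ay|nAy] := pselect (A y); last first.
  move: (nAy); rewrite {1}AE => /separation[v [a [vy aV]]].
  have vy0 : 0 < a - dot v y by rewrite subr_gt0.
  apply: small_imp (small_gt0 (- dot v u) vy0) => e _ H; split; last by case.
  by rewrite AE => /aV; rewrite dotDr dotZr leNgt => /negP;
    rewrite -subr_gt0 opprD addrA -mulrN.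
have [Gu|nGu] := pselect (in_cone (tangent y) u^T).
  by apply: small_imp (tangentP Ay Gu) => e _ H; split.
by exists 1 => // e /andP[e0 _]; split=> [/(in_cone_tangent e0)|[]].
Qed.

End TangentCone.

(** * Triangulations of normal fans *)

Section Triangulations.
Context {R : realType} {d : nat}.
Implicit Types (v x y : 'rV[R]_d) (A : set 'rV[R]_d) (C : 'M[R]_d) (T : seq 'M[R]_d).

Lemma cone_ofP C v : C \in unitmx -> cone_of C v <-> dual_cone (normals C) v.
Proof.
have E (t : 'I_d -> R) : \sum_j t j *: row j C = (\row_j t j) *m C.
  by rewrite mulmx_sum_row; apply: eq_bigr => j _; rewrite mxE.
move=> uC; rewrite /dual_cone all_map all_enum; split=> [[t t0 <-]|/forallP H].
  by apply/forallP => j /=; rewrite pairing_col E mulmxK // mxE.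
exists (fun j => (v *m invmx C) 0 j) => [j|]; first by rewrite -pairing_col; apply: H.
rewrite E (_ : \row_j _ = v *m invmx C) ?mulmxKV //.
by apply/rowP => j; rewrite mxE.
Qed.

Lemma cone_of0 C : cone_of C 0.
Proof. by exists (fun=> 0) => //; rewrite big1 // => j _; rewrite scale0r. Qed.

Lemma row_cone_of C j : cone_of C (row j C).
Proof.
exists (fun k => (k == j)%:R) => [k|]; first exact: ler0n.
rewrite (bigD1 j) //= eqxx scale1r big1 ?addr0 // => k /negPf ->.
by rewrite scale0r.
Qed.

(** The cone lies in the normal cone of one nonempty face, any point of which will do. *)
Lemma triangulation_minimizer A T C : is_polytope A ->
  is_triangulation (normal_fan A) T -> C \in T ->
  exists y, forall v, cone_of C v -> minimizes A v y.
Proof.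
move=> Ap [_ + _ _] => /[apply] -[_ _ [_ [F [FA [y Fy]] <-] CF]].
exists y => v /CF/(_ y Fy); apply: support_fun_minimizes => //.
by case: FA Fy => [-> //|[h ->]] [].
Qed.

Lemma triangulation_cover A T v : is_polytope A ->
  is_triangulation (normal_fan A) T -> exists2 C, C \in T & cone_of C v.
Proof.
move=> Ap [_ _ _ TA]; have [y ymin] := polytope_minimizer Ap v.
have [faceF Fv] := minimizer_face A v.
have : (\bigcup_(C in [set` T]) cone_of C) v.
  rewrite TA; exists (normal_cone A [set x | minimizes A v x]) => //.
  by exists [set x | minimizes A v x] => //; split=> //; exists y.
by move=> [C CT Cv]; exists C.
Qed.

(** The cones attached to [y] tile the normal cone at [y], the dual of the tangent cone. A generic
    form has a single minimizer, so a cone containing it must belong to [y], and it lies in no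
    common face of two cones. *)
Lemma triangulation_local A V T (y_ : 'M[R]_d -> 'rV[R]_d) y :
  A = conv_hull [set` V] -> is_polytope A -> is_triangulation (normal_fan A) T ->
  (forall C v, C \in T -> cone_of C v -> minimizes A v (y_ C)) -> A y ->
  exists2 B : seq 'cV[R]_d, forall b, b \in B -> b != 0 &
    forall v, (forall b, b \in B -> pairing v b != 0) ->
    \sum_(C <- T | y_ C == y) (dual_cone (normals C) v)%:R
    = (dual_cone (tangent V y) v)%:R :> R.
Proof.
move=> AE Ap Ttri y_min Ay; have [uT Tu _ _] := Ttri.
have cP C v : C \in T -> cone_of C v <-> dual_cone (normals C) v.
  by case/Tu => uC _ _; apply: cone_ofP.
have [|h hP] := @choice _ _ (fun (CC : 'M[R]_d * 'M[R]_d) (h : 'rV[R]_d) =>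
    CC.1 \in T -> CC.2 \in T -> CC.1 != CC.2 ->
    h != 0 /\ forall v, cone_of CC.1 v -> cone_of CC.2 v -> dot h v = 0).
  move=> CC.
  have [[C1 C2 CC12]|nCC] :=
      pselect [/\ CC.1 \in T, CC.2 \in T & CC.1 != CC.2]; last first.
    by exists 0 => C1 C2 C12; case: nCC.
  have [_ _ /(_ _ _ C1 C2 CC12) [pf _] _] := Ttri.
  have [h h0 hv] := proper_face_normal pf (conj (cone_of0 CC.1) (cone_of0 CC.2)).
  exists h => _ _ _; split=> // v v1 v2.
  by rewrite -[v]subr0; apply: hv.
(* Excluded are the hyperplanes holding intersections of two cones, and the forms that take equal
   values at [y] and another vertex [y_ C]. *)
exists ([seq (h CC)^T | CC <- [seq (C, C') | C <- T, C' <- T] & CC.1 != CC.2]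
        ++ [seq b <- [seq (y_ C - y)^T | C <- T] | b != 0]).
  move=> b; rewrite mem_cat => /orP[|]; last by rewrite mem_filter => /andP[].
  case/mapP => CC; rewrite mem_filter => /andP[neq /allpairsP[[C C'] [CT CT' E]]] ->.
  rewrite -(trmx0 _ _ _) (inj_eq trmx_inj).
  by move: neq; rewrite E /= => neq; case: (hP (C, C')).
move=> v vB; have [yv|nyv] := boolP (dual_cone _ v); last first.
  rewrite big_seq_cond big1 // => C /andP[CT /eqP yC].
  case: (boolP (dual_cone _ v)) => // Cv; case/negP: nyv.
  apply/(dual_cone_tangent AE v Ay); rewrite -yC; apply: (y_min _ _ CT).
  exact/cP.
have [C CT Cv] := triangulation_cover v Ap Ttri.
have yC : y_ C = y.
  apply/eqP; rewrite -subr_eq0; apply: contraT => yC.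
  have := vB (y_ C - y)^T; rewrite -dotE dotBr.
  have [yv1 yv2] : minimizes A v y by apply/(dual_cone_tangent AE v Ay).
  have [Cv1 Cv2] := y_min _ _ CT Cv.
  have -> : dot v (y_ C) = dot v y by apply/eqP; rewrite eq_le Cv2 // yv2.
  rewrite subrr eqxx; apply; rewrite mem_cat; apply/orP; right.
  rewrite mem_filter -{1}(trmx0 _ _ _) (inj_eq trmx_inj) yC /=.
  by apply/mapP; exists C.
have dC : dual_cone (normals C) v by apply/cP.
rewrite big_mkcond (bigD1_seq C) //= yC eqxx dC big_seq_cond big1 ?addr0 //.
move=> C' /andP[C'T C'C]; case: eqP => // _.
case: (boolP (dual_cone _ v)) => // C'v.
have {}C'v : cone_of C' v by apply/cP.
have [h0 hv] := hP (C', C) C'T CT C'C.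
have := vB (h (C', C))^T; rewrite -dotE dotC hv // eqxx => F.
suff : ~~ true by []; apply: F.
rewrite mem_cat; apply/orP; left; apply/map_f.
by rewrite mem_filter C'C /=; apply/allpairsP; exists (C', C).
Qed.

End Triangulations.

(** * Decomposing vertices of a Minkowski sum *)

Section MinkowskiMinimizers.
Context {R : realType} {d r : nat} (X : 'I_r -> set 'rV[R]_d).
Implicit Types (v : 'rV[R]_d) (p : 'I_r -> 'rV[R]_d).

Lemma minimizes_summand v p i : (forall i, X i (p i)) ->
  minimizes (minkowski_sum X) v (\sum_i p i) -> minimizes (X i) v (p i).
Proof.
move=> Xp [_ minp]; split=> // y Xy.
have : minkowski_sum X (\sum_j if j == i then y else p j).
  by exists (fun j => if j == i then y else p j) => // j; case: eqP => [->|].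
move/minp; rewrite !dot_sumr (bigD1 i) //= [in X in _ <= X](bigD1 i) //= eqxx.
rewrite [X in _ <= _ + X](eq_bigr (fun j => dot v (p j))) ?lerD2r // => j.
by move=> /negPf ->.
Qed.

Lemma triangulation_summands T C : (forall i, is_polytope (X i)) ->
  is_triangulation (normal_fan (minkowski_sum X)) T -> C \in T ->
  exists p, forall v, cone_of C v -> minimizes (minkowski_sum X) v (\sum_i p i) /\
    forall i, minimizes (X i) v (p i).
Proof.
move=> Xp Ttri CT.
have [y ymin] := triangulation_minimizer (minkowski_sum_polytope Xp) Ttri CT.
have [[p pX yE] _] := ymin 0 (cone_of0 C).
exists p => v /ymin; rewrite -yE => vmin; split=> // i.
exact: minimizes_summand.
Qed.

(** For each row of [C] the differences of values at [p' i] and [p i] are nonnegative with sum 0,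
    hence all vanish; the rows span the space. *)
Lemma summands_unique (C : 'M[R]_d) p p' : C \in unitmx ->
  (forall v, cone_of C v -> forall i, minimizes (X i) v (p i)) ->
  (forall i, X i (p' i)) -> \sum_i p' i = \sum_i p i -> p' = p.
Proof.
move=> uC pmin Xp' E; apply/funext => i; apply/eqP; rewrite -subr_eq0.
rewrite -(inj_eq trmx_inj) trmx0 -(mulKmx uC (p' i - p i)^T).
suff -> : C *m (p' i - p i)^T = 0 by rewrite mulmx0.
apply/colP => j; transitivity (dot (row j C) (p' i - p i)).
  by rewrite dotE /pairing -row_mul !mxE.
rewrite mxE dotBr.
have H := @psumr_eq0P _ _ predT (fun i => dot (row j C) (p' i) - dot (row j C) (p i)).
apply: H => // [k _|]; first by rewrite subr_ge0 (pmin _ (row_cone_of C j) k).2.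
by rewrite sumrB -!dot_sumr E subrr.
Qed.

End MinkowskiMinimizers.

(** Membership of [u] in the tangent cones is membership of [y + e *: u] in the polytopes for small
    [e]. A generic such point of [A] lies in exactly one cell, as the intersection of two cells
    containing [y] lies in a hyperplane through [y]. *)
Lemma subdivision_tangent (R : realType) d n (A : set 'rV[R]_d)
    (Y : 'I_n -> set 'rV[R]_d) V (W : 'I_n -> seq 'rV[R]_d) y :
  A = conv_hull [set` V] -> (forall a, Y a = conv_hull [set` W a]) ->
  \bigcup_(a in [set: 'I_n]) Y a = A ->
  (forall a b, a != b -> intersect_properly (Y a) (Y b)) ->
  exists2 B : seq 'rV[R]_d, forall b, b \in B -> b != 0 &
    forall u, (forall b, b \in B -> pairing b u != 0) ->
    \sum_(a < n) `[< Y a y /\ in_cone (tangent (W a) y) u >]%:R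
    = `[< A y /\ in_cone (tangent V y) u >]%:R :> R.
Proof.
move=> AE YE YA Yint.
have [|h hP] := @choice _ _ (fun (ab : 'I_n * 'I_n) (h : 'rV[R]_d) =>
    ab.1 != ab.2 -> Y ab.1 y -> Y ab.2 y ->
    h != 0 /\ forall z, Y ab.1 z -> Y ab.2 z -> dot h (z - y) = 0).
  move=> [a b] /=.
  have [[ab ya yb]|nab] := pselect [/\ a != b, Y a y & Y b y]; last first.
    by exists 0 => ab ya yb; case: nab.
  have [pf _] := Yint a b ab.
  have [h h0 hz] := proper_face_normal pf (conj ya yb).
  by exists h => _ _ _; split=> // z za zb; apply: hz.
exists [seq b <- [seq h ab | ab : 'I_n * 'I_n] | b != 0].
  by move=> b; rewrite mem_filter => /andP[].
move=> u uB; have [e e0 [eA eY]] := small_ex (small_and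
  (small_tangent AE y u^T)
  (@small_all R 'I_n (enum 'I_n) (fun a e => Y a (y + e *: u^T) <->
     Y a y /\ in_cone (tangent (W a) y) u^T^T)
     (fun a _ => small_tangent (YE a) y u^T))).
rewrite trmxK in eA; rewrite -(asbool_equiv_eq eA).
under eq_bigr => a _ do rewrite -[in in_cone _ _](trmxK u)
  -(asbool_equiv_eq (eY a (mem_enum _ a))).
set z := y + _; have [Az|nAz] := pselect (A z); last first.
  rewrite asboolF // big1 // => a _; rewrite asboolF // => Yz.
  by apply: nAz; rewrite -YA; exists a.
have [a _ Yaz] : (\bigcup_(a in [set: 'I_n]) Y a) z by rewrite YA.
rewrite (asboolT Az) (bigD1 a) //= asboolT // big1 ?addr0 // => b ba.
rewrite asboolF // => Ybz.
have [Yay _] := (eY a (mem_enum _ a)).1 Yaz.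
have [Yby _] := (eY b (mem_enum _ b)).1 Ybz.
have [h0 /(_ z Ybz Yaz)] := hP (b, a) ba Yby Yay.
rewrite /z addrC addKr dotZr => /eqP; rewrite mulf_eq0 gt_eqF //= => /eqP hu.
have := uB (h (b, a)); rewrite mem_filter h0 map_f ?mem_enum // => /(_ isT).
by rewrite -[u]trmxK -dotE hu eqxx.
Qed.

Section SupportForm.
Context {R : realType} {d r : nat} (X : 'I_r -> set 'rV[R]_d).

(** On forms minimized at the same points [p i], the denominators are linear in [v]: this is where
    [z - sum_i x_i p_i] enters. *)
Lemma support_form_eval v rho p : (forall i, minimizes (X i) v (p i)) ->
  (support_form X v).@[rho] =
  dot v (\row_k rho (rshift r k) - \sum_i rho (lshift d i) *: p i).
Proof.
move=> pmin; rewrite dotBr dot_sumr /support_form mevalD !raddf_sum /= addrC.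
congr (_ + _); first by apply: eq_bigr => k _; rewrite mevalZ mevalXU mxE.
apply: eq_bigr => i _.
by rewrite mevalZ mevalXU (support_funE (pmin i)) dotZr mulNr mulrC.
Qed.

Lemma support_form_neq0 v : v != 0 -> support_form X v != 0.
Proof.
move=> v0; apply/negP => /eqP E.
(* At [x = 0] and [z = v] the form takes the value [dot v v]. *)
have := congr1 (meval (fun j => match fintype.split j with
  inl _ => 0 | inr k => v 0 k end)) E.
rewrite meval0 /support_form mevalD !raddf_sum /= big1 => [|i _]; last first.
  by rewrite mevalZ mevalXU (unsplitK (inl i)) mulr0.
rewrite add0r (eq_bigr (fun k => v 0 k * v 0 k)) => [|k _]; last first.
  by rewrite mevalZ mevalXU (unsplitK (inr k)).
by move/eqP; rewrite -/(dot v v) dotvv_eq0 (negPf v0).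
Qed.

End SupportForm.

(** * Assembling the identity vertex by vertex *)

Theorem theorem9p4 (R : realType) (d r n : nat)
    (P : 'I_r -> set 'rV[R]_d) (Q : 'I_n -> 'I_r -> set 'rV[R]_d)
    (T : seq 'M[R]_d) (TQ : 'I_n -> seq 'M[R]_d) :
  (forall i, is_polytope (P i)) ->
  full_dimensional (minkowski_sum P) ->
  is_mixed_subdivision P Q ->
  is_triangulation (normal_fan (minkowski_sum P)) T ->
  (forall a, is_triangulation (normal_fan (minkowski_sum (Q a))) (TQ a)) ->
  (dual_mixed_volume P T = \sum_(a < n) dual_mixed_volume (Q a) (TQ a))%R.
Proof.
move=> Pp _ [Qcell Qcover Qint] Ttri TQtri.
have QP a i := minkowski_cell_polytope Pp (Qcell a) i.
(* [None] stands for [P] and [Some a] for a cell, with signs 1 and -1, so that the claim becomes the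
   vanishing of one signed sum. *)
pose X (o : option 'I_n) := if o is Some a then Q a else P.
pose TT (o : option 'I_n) := if o is Some a then TQ a else T.
pose sg (o : option 'I_n) : R := if o is Some a then -1 else 1.
pose os := None :: [seq Some a | a : 'I_n].
have Xp o i : is_polytope (X o i) by case: o => [a|] //; case: (QP a i).
have XP o i : X o i `<=` P i by case: o => [a|] //; case: (QP a i).
have Yp o := minkowski_sum_polytope (Xp o).
have Ytri o : is_triangulation (normal_fan (minkowski_sum (X o))) (TT o).
  by case: o.
have [V VE] := choice (fun o => let: ex_intro2 s _ E := Yp o in
  ex_intro (fun s => minkowski_sum (X o) = conv_hull [set` s]) s E).
pose items := [seq (o, C) | o <- os, C <- TT o].
have itemsP x : x \in items -> x.2 \in TT x.1.
  by case/allpairsPdep => o [C [_ CT ->]].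
have itemsU x : x \in items -> x.2 \in unitmx.
  by move/itemsP => xT; have [_ /(_ _ xT)[]] := Ytri x.1.
have [|p pP] := @choice _ _ (fun (x : option 'I_n * 'M[R]_d) (p : 'I_r -> 'rV[R]_d) =>
    x.2 \in TT x.1 -> forall v, cone_of x.2 v ->
      minimizes (minkowski_sum (X x.1)) v (\sum_i p i) /\
      forall i, minimizes (X x.1 i) v (p i)).
  move=> [o C] /=; have [CT|nCT] := pselect (C \in TT o); last by exists (fun=> 0).
  by have [p pP] := triangulation_summands (Xp o) (Ytri o) CT; exists p.
pose y x := \sum_i p x i.
have pX x i : x \in items -> X x.1 i (p x i).
  by move/itemsP/pP/(_ 0 (cone_of0 _)) => [_ /(_ i)[]].
have p_unique x p' : x \in items -> (forall i, X x.1 i (p' i)) ->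
    \sum_i p' i = y x -> p' = p x.
  move=> xi; apply: summands_unique (itemsU x xi) _ => v xv i.
  by have [_] := pP x (itemsP x xi) v xv.
(* The summands of a vertex [y x] do not depend on the cell: vertices of two
   cells that coincide lie in their intersection, which decomposes. *)
have p_y x x' : x \in items -> x' \in items -> y x = y x' -> p x = p x'.
  case: x x' => [[a|] C] [[b|] C'] xi xi' yE.
  - have [ab|ab] := eqVneq a b.
      by subst b; apply: (p_unique (Some a, C')) => // i; apply: (pX (Some a, C)).
    have [_ _ QQ] := Qint a b ab.
    have : (minkowski_sum (Q a) `&` minkowski_sum (Q b)) (y (Some a, C)).
      split; first by exists (p (Some a, C)) => // i; apply: (pX (Some a, C)).
      by rewrite yE; exists (p (Some b, C')) => // i; apply: (pX (Some b, C')).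
    rewrite QQ => -[p' p'P p'y].
    rewrite -(p_unique (Some a, C) p') // => [|i]; last by case: (p'P i).
    by apply: (p_unique (Some b, C')) => [|i|] //; [case: (p'P i) | rewrite p'y].
  - by apply: (p_unique (None, C')) => // i; apply: XP; apply: (pX (Some a, C)).
  - symmetry; apply: (p_unique (None, C)) => // i.
    by apply: XP; apply: (pX (Some b, C')).
  - by apply: (p_unique (None, C')) => // i; apply: (pX (None, C)).
have sum_os (W : nmodType) (f : option 'I_n -> W) :
    \sum_(o <- os) f o = f None + \sum_a f (Some a).
  by rewrite big_cons big_map big_enum.
pose D x (j : 'I_d) := support_form (X x.1) (row j x.2).
apply/eqP; rewrite -subr_eq0; apply/eqP.
transitivity (\sum_(x <- items)
    tofrac (sg x.1 * `|\det x.2|)%:MP / \prod_j tofrac (D x j)).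
  rewrite big_allpairs_dep sum_os /= -sumrN; congr (_ + _).
    by apply: eq_bigr => C _; rewrite mul1r.
  apply: eq_bigr => a _; rewrite -sumrN; apply: eq_bigr => C _.
  by rewrite mulN1r mpolyCN rmorphN mulNr.
apply: sum_tofrac_eq0 => [x j xi|rho Drho].
  apply: support_form_neq0; apply/eqP => /(congr1 (mulmx^~ (invmx x.2))).
  rewrite mul0mx -row_mul mulmxV ?itemsU // => /rowP/(_ j)/eqP.
  by rewrite !mxE eqxx oner_eq0.
(* Collect the cones by the vertex they belong to; by [p_y] they share the summands of [y0], hence
   one vector [w]. *)
apply: (@big_fibers0 _ _ _ _ y) => y0.
have [[x0 x0i /eqP x0y]|nox] :=
    pselect (exists2 x, x \in items & y x == y0); last first.
  by rewrite big_seq_cond big1 // => x /andP[xi xy]; case: nox; exists x.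
pose w := (\row_k rho (rshift r k) - \sum_i rho (lshift d i) *: p x0 i)^T.
have Dw x j : x \in items -> y x = y0 -> (D x j).@[rho] = (x.2 *m w) j 0.
  move=> xi xy; rewrite (@support_form_eval _ _ _ _ _ _ (p x)) => [|i].
    rewrite (p_y _ _ xi x0i) ?x0y // dotE -/w.
    by rewrite /pairing -row_mul mxE.
  by have [] := pP x (itemsP x xi) _ (row_cone_of x.2 j).
pose T' := [seq (sg x.1, x.2) | x <- items & y x == y0].
(* All polytopes containing [y0] take part, even where [y0] is not a vertex; the simplicial cones in
   [T'] then add up to the duals generically. *)
pose K := [seq (sg o, tangent (V o) y0)
          | o <- os & `[< minkowski_sum (X o) y0 >]].
have T'P s : s \in T' -> exists x, [/\ x \in items, y x = y0 & s = (sg x.1, x.2)].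
  by case/mapP => x; rewrite mem_filter => /andP[/eqP ? ?] ->; exists x.
have os_mem o : o \in os.
  by case: o => [a|]; rewrite inE //= map_f ?mem_enum.
have itemsI o C : C \in TT o -> (o, C) \in items.
  by move=> CT; apply/allpairsPdep; exists o, C.
have [|B BP] := @choice _ _ (fun (o : option 'I_n) (B : seq 'cV[R]_d) =>
    (forall b, b \in B -> b != 0) /\ (minkowski_sum (X o) y0 ->
    forall v, (forall b, b \in B -> pairing v b != 0) ->
    \sum_(C <- TT o | y (o, C) == y0) (dual_cone (normals C) v)%:R
    = (dual_cone (tangent (V o) y0) v)%:R :> R)).
  move=> o; have [oy|noy] := pselect (minkowski_sum (X o) y0); last by exists [::].
  have [|B B0 BE] := triangulation_local (y_ := fun C => y (o, C))
      (VE o) (Yp o) (Ytri o) _ oy; last by exists B.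
  by move=> C v CT Cv; have [] := pP (o, C) CT v Cv.
have [B' B'0 B'E] := subdivision_tangent y0 (VE None) (fun a => VE (Some a)) Qcover
  (fun a b ab => let: And3 _ h _ := Qint a b ab in h).
transitivity (\sum_(s <- T') s.1 * cone_weight s.2 w).
  rewrite big_map big_filter big_seq_cond [RHS]big_seq_cond.
  apply: eq_bigr => x /andP[xi /eqP xy] /=; rewrite -mulrA /cone_weight.
  by under eq_bigr do rewrite Dw //.
apply: (@cone_weight_sum_eq0 _ _ _ T' K (flatten [seq B o | o <- os]) B') => //.
- by move=> s /T'P[x [xi _ ->]]; apply: itemsU.
- by move=> s k /T'P[x [xi xy ->]]; rewrite -Dw // Drho.
- by move=> b /flatten_mapP[o _]; apply: (BP o).1.
- move=> v vB; rewrite !big_map !big_filter [LHS]big_mkcond [RHS]big_mkcond.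
  rewrite big_allpairs_dep; apply: eq_bigr => o _ /=; rewrite -big_mkcond.
  rewrite -mulr_sumr; case: asboolP => oy.
    rewrite (BP o).2 // => b bB; apply: vB.
    by apply/flatten_mapP; exists o.
  rewrite big_seq_cond big1 ?mulr0 // => C /andP[CT /eqP yC]; case: oy.
  by rewrite -yC; exists (p (o, C)) => // i; apply: (pX (o, C)); apply: itemsI.
(* The primal relation: generically the tangent cones of the cells at [y0] tile that of the whole
   sum. *)
move=> u uB; rewrite big_map big_filter big_mkcond sum_os /=.
have andE (a b : Prop) (t : R) :
    (if `[< a >] then t * `[< b >]%:R else 0) = t * `[< a /\ b >]%:R.
  by rewrite asbool_and; case: `[< a >]; rewrite ?mulr0.
rewrite andE -B'E // mul1r; under [X in _ + X]eq_bigr do rewrite andE mulN1r.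
by rewrite sumrN subrr.
Qed.
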